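(* Let $\mathcal{A}=\{a_0,\dots,a_k\}\subset\mathbb{P}^1$ be distinct points, let $n\geq 2$ be an integer, and let $X_n$ be the abelian cover of $\mathbb{P}^1$ ramified at $\mathcal{A}$ corresponding to the surjection $\pi_1(\mathbb{P}^1\setminus\mathcal{A})\to H_1(\mathbb{P}^1\setminus\mathcal{A},\mathbb{Z}/n\mathbb{Z})$. Let $\chi\neq1$ be a character of $H_1(\mathbb{P}^1\setminus\mathcal{A},\mathbb{Z}/n\mathbb{Z})$ with $$\chi(\delta_i)=\exp\left(\frac{2\pi\sqrt{-1}\,j_i}{n}\right)\neq1,\qquad 1\le j_i<n,\quad i=0,\dots,k,$$ where $\delta_i$ is the class of the boundary of a small disk about $a_i$. Assume that $\gcd(j_0,\dots,j_k)=1$ and let $M=\sum_{i=1}^{k}(n-j_i)$. Then $$\dim H^{1,0}(X_n)_\chi=\left[\frac{M}{n}\right],$$ where $[\cdot]$ denotes the integer part.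
   Context: All varieties are over $\mathbb{C}$; $X_n$ is the smooth projective curve compactifying the corresponding unramified cover of $\mathbb{P}^1\setminus\mathcal{A}$. Choosing the coordinate $x$ on $\mathbb{P}^1$ so that $a_0=\infty$, $X_n$ is the smooth projective model of the affine curve in $\mathbb{C}^{k+1}$ given by $z_1^n=x-a_1,\dots,z_k^n=x-a_k$. The element $\delta_i$ ($1\le i\le k$) of the Galois group $H_1(\mathbb{P}^1\setminus\mathcal{A},\mathbb{Z}/n\mathbb{Z})$ acts by $z_i\mapsto \exp(2\pi\sqrt{-1}/n)z_i$ and fixes $x$ and the other $z_j$, and $\delta_0=-(\delta_1+\dots+\delta_k)$. $H^{1,0}(X_n)_\chi$ is the subspace of holomorphic $1$-forms $\omega$ on $X_n$ with $g^*\omega=\chi(g)\omega$ for all $g$ in the Galois group. *)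

(* Defs.v *)
From HB Require Import structures.
From mathcomp Require Import all_boot all_order all_algebra complex.
From mathcomp Require Import reals trigo.

Set Implicit Arguments.
Unset Strict Implicit.
Unset Printing Implicit Defensive.

Import Order.TTheory GRing.Theory Num.Theory.
Local Open Scope ring_scope.
Local Open Scope complex_scope.

(* The complex numbers are R[i], with R : realType. *)

(* exp (sqrt(-1) * t) *)
Definition expi (R : realType) (t : R) : R[i] := cos t +i* sin t.

(* Some c is the point [c : 1] of the projective line, None is [1 : 0]. *)
Definition P1 (R : realType) : Type := option R[i].

Definition mobius (R : realType) (g : 'M[R[i]]_2) (p : P1 R) : P1 R :=
  let: (u, v) := if p is Some c then (c, 1) else (1, 0) in
  let u' := g 0 0 * u + g 0 1 * v in
  let v' := g 1 0 * u + g 1 1 * v in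
  if v' == 0 then None else Some (u' / v').

(* H_1(P^1 minus A, Z/n) is generated by the classes delta_0, ..., delta_k of
   the loops around the points of A, subject only to n delta_i = 0 and
   delta_0 + ... + delta_k = 0, so it is free over Z/n on delta_1, ..., delta_k.
   ('Z_n is Z/n for n >= 2.) *)
Definition H1 (n k : nat) : zmodType := 'rV['Z_n]_k.

Definition delta (n k : nat) (i : 'I_k.+1) : H1 n k :=
  if unlift ord0 i is Some i' then delta_mx 0 i'
  else - \sum_(i' < k) delta_mx 0 i'.

Definition is_character (R : realType) (G : zmodType) (chi : G -> R[i]) :=
  chi 0 = 1 /\ forall u v, chi (u + v) = chi u * chi v.

(* A smooth projective curve over C is given by its field K of rational
   functions: its points are the normalized discrete valuations of K over C
   (below), so the smooth projective model of an affine curve is determined by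
   the function field of that curve. The following is the function field of
   the curve z_i ^ n = x - b_i (1 <= i <= k). *)
Record abelian_cover (R : realType) (n k : nat) (b : 'I_k -> R[i]) := Cover {
  fct :> fieldType;
  cst : {rmorphism R[i] -> fct};
  xfun : fct;
  zfun : 'I_k -> fct;
  xfun_transcendental : ~ algebraicOver cst xfun;
  zfun_eq : forall i, zfun i ^+ n = xfun - cst (b i);
  fct_generated : forall S : divringClosed fct,
    (forall c, cst c \in S) -> xfun \in S -> (forall i, zfun i \in S) ->
    forall f, f \in S
}.
Arguments cst {R n k b} c : rename.
Arguments xfun {R n k b} c : rename.
Arguments zfun {R n k b} c i : rename.

Section Curve.
Variables (R : realType) (n k : nat) (b : 'I_k -> R[i]) (X : abelian_cover n b).

(* u |-> u^* on rational functions. *)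
Definition galois_action (act : H1 n k -> {rmorphism X -> X}) :=
  [/\ forall f, act 0 f = f,
      forall u v f, act (u + v) f = act u (act v f),
      forall u c, act u (cst X c) = cst X c,
      forall u, act u (xfun X) = xfun X
    & forall i j : 'I_k, act (delta n (lift ord0 i)) (zfun X j) =
        if j == i then cst X (expi (2 * pi / n%:R)) * zfun X j else zfun X j].

(* The value of [ord] at 0 is irrelevant. *)
Record curve_point := CurvePoint {
  ord :> X -> int;
  ord_mul : forall f g, f != 0 -> g != 0 -> ord (f * g) = ord f + ord g;
  ord_add : forall f g, f != 0 -> g != 0 -> f + g != 0 ->
    Num.min (ord f) (ord g) <= ord (f + g);
  ord_cst : forall c, c != 0 -> ord (cst X c) = 0;
  ord_normalized : exists2 t, t != 0 & ord t = 1
}.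

Definition regular_fun (P : curve_point) (f : X) := f = 0 \/ 0 <= P f.

Definition derivation (V : lmodType X) (D : X -> V) :=
  [/\ forall f g, D (f + g) = D f + D g,
      forall f g, D (f * g) = f *: D g + g *: D f
    & forall c, D (cst X c) = 0].

(* d : K -> Om is the universal C-derivation: Om is the space of rational
   1-forms (Kaehler differentials) of X. *)
Definition kaehler (Om : lmodType X) (d : X -> Om) :=
  derivation d /\
  forall (V : lmodType X) (D : X -> V), derivation D ->
    exists phi : {linear Om -> V},
      (forall f, phi (d f) = D f) /\
      (forall psi : {linear Om -> V}, (forall f, psi (d f) = D f) -> psi =1 phi).

Variables (Om : lmodType X) (d : X -> Om).

(* om lies in the stalk at P of the sheaf of Kaehler differentials, i.e. in
   the O_P-submodule generated by the dg, g in O_P. *)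
Definition regular_at (P : curve_point) (om : Om) :=
  exists (m : nat) (f g : 'I_m -> X),
    (forall i, regular_fun P (f i) /\ regular_fun P (g i)) /\
    om = \sum_(i < m) f i *: d (g i).

(* By GAGA, the holomorphic 1-forms on a smooth projective curve are the
   rational 1-forms that are regular at every point. *)
Definition holomorphic (om : Om) := forall P : curve_point, regular_at P om.

(* u |-> u^* on rational 1-forms: u^*(f dg) = (u^* f) d(u^* g). *)
Definition is_pullback (act : H1 n k -> {rmorphism X -> X})
    (pb : forall u, {linear Om -> Om | act u \; *:%R}) :=
  forall u f, pb u (d f) = d (act u f).

Definition H10chi (act : H1 n k -> {rmorphism X -> X})
    (pb : forall u, {linear Om -> Om | act u \; *:%R})
    (chi : H1 n k -> R[i]) (om : Om) :=
  holomorphic om /\ forall u, pb u om = cst X (chi u) *: om.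

(* The C-subspace V has a basis of N elements. *)
Definition has_dim (V : Om -> Prop) (N : nat) :=
  exists e : 'I_N -> Om,
    [/\ forall i, V (e i),
        forall om, V om ->
          exists c : 'I_N -> R[i], om = \sum_(i < N) cst X (c i) *: e i
      & forall c : 'I_N -> R[i], \sum_(i < N) cst X (c i) *: e i = 0 ->
          forall i, c i = 0].

End Curve.

(* Main.v *)
Require Import Defs.
From HB Require Import structures.
From mathcomp Require Import all_boot all_order all_algebra complex.
From mathcomp Require Import reals trigo.
From mathcomp Require Import boolp ring lra zify.

Set Implicit Arguments.
Unset Strict Implicit.
Unset Printing Implicit Defensive.

Import Order.TTheory GRing.Theory Num.Theory.
Local Open Scope ring_scope.
Local Open Scope complex_scope.

(** A form in the chi-eigenspace is uniquely f(x) prod_i z_i^(j_i - n) dx with f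
    a rational function. Near a point over b_i the z_i is a local parameter and
    dx = n z_i^(n-1) dz_i, so such a form is regular there iff f has no pole at
    b_i; over the other finite points it is again regular iff f has no pole.
    At infinity z_i has a simple pole and x a pole of order n, and regularity
    means n deg f + n + 1 <= M. As chi(delta_0) <> 1, n does not divide M, and
    there are exactly M / n monomials x^m with this property.

    To test regularity at a point one needs that point: it is obtained by
    embedding the function field in the field of Laurent series in a local
    parameter. Such an embedding exists as soon as the equations of the cover
    are solved by Laurent series, because the elements of the function field
    have a unique normal form (sum_e p_e(x) prod_i z_i^(e_i)) / q(x), the
    summands being eigenvectors of the Galois group for distinct characters.
    The derivative of Laurent series then gives a linear map on Kaehler
    differentials that is nonnegative on regular forms. *)

(** * Formal power series *)

Section PowerSeries.
Variable F : fieldType.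

(** Equality of coefficient sequences is not decidable, so the equality and choice structures are
    the classical ones. *)
Definition fps : Type := nat -> F.
HB.instance Definition _ := gen_eqMixin fps.
HB.instance Definition _ := gen_choiceMixin fps.
Implicit Types (a b c : fps) (p q : {poly F}).

Definition fps_of_poly p : fps := fun m => p`_m.
Definition fps_trunc (N : nat) a : {poly F} := \poly_(i < N) a i.
Definition fps_add a b : fps := fun m => a m + b m.
Definition fps_opp a : fps := fun m => - a m.
Definition fps_mul a b : fps := fun m => \sum_(i < m.+1) a i * b (m - i)%N.

(** Coefficient m of a product involves only coefficients up to m, so ring identities and the
    Leibniz rule are inherited from polynomial truncations. *)
Lemma fps_mul_trunc N m a b :
  (m < N)%N -> fps_mul a b m = (fps_trunc N a * fps_trunc N b)`_m.
Proof.
move=> ltmN; rewrite coefM; apply: eq_bigr => i _; rewrite !coef_poly.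
by rewrite (leq_ltn_trans (leq_ord i) ltmN) (leq_ltn_trans (leq_subr _ _) ltmN).
Qed.

Let addA : associative fps_add.
Proof. by move=> a b c; apply/funext => m; apply: addrA. Qed.
Let addC : commutative fps_add.
Proof. by move=> a b; apply/funext => m; apply: addrC. Qed.
Let add0 : left_id (fps_of_poly 0) fps_add.
Proof. by move=> a; apply/funext => m; rewrite /fps_add /fps_of_poly coef0 add0r. Qed.
Let addN : left_inverse (fps_of_poly 0) fps_opp fps_add.
Proof. by move=> a; apply/funext => m; rewrite /fps_add /fps_of_poly coef0; apply: addNr. Qed.

HB.instance Definition _ := GRing.isZmodule.Build fps addA addC add0 addN.

Let mulC : commutative fps_mul.
Proof.
by move=> a b; apply/funext => m; rewrite !(fps_mul_trunc _ _ (ltnSn m)) mulrC.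
Qed.
Let mulA : associative fps_mul.
Proof.
move=> a b c; apply/funext => m.
have truncM u v i : (i <= m)%N ->
    fps_mul u v i = (fps_trunc m.+1 u * fps_trunc m.+1 v)`_i.
  by move=> leim; rewrite (fps_mul_trunc (N := m.+1)).
have trunc1 u i : (i <= m)%N -> u i = (fps_trunc m.+1 u)`_i.
  by move=> leim; rewrite coef_poly ltnS leim.
transitivity ((fps_trunc m.+1 a * (fps_trunc m.+1 b * fps_trunc m.+1 c))`_m).
  rewrite coefM; apply: eq_bigr => i _.
  by rewrite -trunc1 ?leq_ord // -truncM // leq_subr.
rewrite mulrA coefM; apply: eq_bigr => i _.
by rewrite -truncM ?leq_ord // -trunc1 // leq_subr.
Qed.
Let mul1 : left_id (fps_of_poly 1) fps_mul.
Proof.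
move=> a; apply/funext => m; rewrite /fps_mul big_ord_recl /fps_of_poly /= coef1.
by rewrite mul1r subn0 big1 ?addr0 // => i _; rewrite coef1 mul0r.
Qed.
Let mulDl : left_distributive fps_mul fps_add.
Proof.
move=> a b c; apply/funext => m; rewrite /fps_add /fps_mul -big_split /=.
by apply: eq_bigr => i _; rewrite mulrDl.
Qed.
Let one_neq0 : fps_of_poly 1 != 0 :> fps.
Proof.
apply/eqP => /(congr1 (fun a : fps => a 0%N))/eqP.
by rewrite -[X in _ == X]/((0 : {poly F})`_0) coef0 /fps_of_poly coef1 oner_eq0.
Qed.

HB.instance Definition _ :=
  GRing.Zmodule_isComNzRing.Build fps mulA mulC mul1 mulDl one_neq0.

Lemma fpsP a b : (forall m, a m = b m) <-> a = b.
Proof. by split=> [eqab|->//]; apply/funext. Qed.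

Lemma fpsDE a b m : (a + b) m = a m + b m. Proof. by []. Qed.
Lemma fpsNE a m : (- a) m = - a m. Proof. by []. Qed.
Lemma fpsME a b m : (a * b) m = \sum_(i < m.+1) a i * b (m - i)%N.
Proof. by []. Qed.
Lemma fps0E m : (0 : fps) m = 0.
Proof. exact: (coef0 F m). Qed.

Lemma fps_of_poly_is_zmod_morphism : zmod_morphism fps_of_poly.
Proof. by move=> p q; apply/fpsP => m; rewrite /fps_of_poly fpsDE fpsNE coefB. Qed.
HB.instance Definition _ := GRing.isZmodMorphism.Build {poly F} fps fps_of_poly
  fps_of_poly_is_zmod_morphism.
Lemma fps_of_poly_is_monoid_morphism : monoid_morphism fps_of_poly.
Proof. by split=> // p q; apply/fpsP => m; rewrite /fps_of_poly fpsME coefM. Qed.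
HB.instance Definition _ := GRing.isMonoidMorphism.Build {poly F} fps fps_of_poly
  fps_of_poly_is_monoid_morphism.

(** Invertibility and inverses are classical; the structure is there so that series form an integral
    domain with a fraction field. *)
Definition fps_unit : pred fps := fun a => `[< exists b, b * a = 1 >].
Definition fps_inv a : fps :=
  if pselect (exists b, b * a = 1) is left e then sval (cid e) else a.
Let fps_mulVr : {in fps_unit, left_inverse 1 fps_inv *%R}.
Proof.
move=> a; rewrite unfold_in /fps_inv => /asboolP ua.
by case: pselect => // e; case: (cid e).
Qed.
Let fps_unitP a b : b * a = 1 -> fps_unit a.
Proof. by move=> ba; apply/asboolP; exists b. Qed.
Let fps_inv_out : {in [predC fps_unit], fps_inv =1 id}.
Proof.
move=> a; rewrite inE unfold_in /fps_inv => /asboolPn nua.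
by case: pselect.
Qed.
HB.instance Definition _ :=
  GRing.ComNzRing_hasMulInverse.Build fps fps_mulVr fps_unitP fps_inv_out.

Lemma fps_neq0P a : a != 0 -> exists m, a m != 0.
Proof.
move=> a0; apply: contrapT => na; case/eqP: a0; apply/fpsP => m.
by rewrite fps0E; apply/eqP; apply: contrapT => /negP am; apply: na; exists m.
Qed.

(** The order of vanishing at the origin; the zero series gets the default value 0. *)
Definition fps_ord a : nat :=
  if pselect (exists m, a m != 0) is left e then ex_minn e else 0%N.

Lemma fps_ordP a : a != 0 ->
  a (fps_ord a) != 0 /\ forall i, (i < fps_ord a)%N -> a i = 0.
Proof.
move=> /fps_neq0P a0; rewrite /fps_ord; case: pselect => // e.
case: ex_minnP => m am minm; split=> // i ltim; apply/eqP.
by apply: contraTT ltim => /minm; rewrite leqNgt.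
Qed.

Lemma fps_ord_eq a m : a m != 0 -> (forall i, (i < m)%N -> a i = 0) -> fps_ord a = m.
Proof.
move=> am ai; have a0 : a != 0 by apply: contraNneq am => ->; rewrite fps0E.
have [ao oi] := fps_ordP a0; have [||//] := ltngtP (fps_ord a) m.
  by move/ai/eqP; rewrite (negbTE ao).
by move/oi/eqP; rewrite (negbTE am).
Qed.

(** No other term of the convolution survives in degree m + l. This yields both integrality and
    additivity of the order. *)
Lemma fpsM_lead a b m l :
    (forall i, (i < m)%N -> a i = 0) -> (forall i, (i < l)%N -> b i = 0) ->
  (a * b) (m + l)%N = a m * b l /\ forall i, (i < m + l)%N -> (a * b) i = 0.
Proof.
move=> ai bi; split.
  have ltm : (m < (m + l).+1)%N by rewrite ltnS leq_addr.
  rewrite fpsME (bigD1 (Ordinal ltm)) //= addKn big1 ?addr0 // => i.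
  rewrite -val_eqE /= => neim; have [/ai->|lt|eqim] := ltngtP i m; first by rewrite mul0r.
    by rewrite bi ?mulr0 // ltn_subLR ?leq_ord // ltn_add2r.
  by rewrite eqim eqxx in neim.
move=> s lts; rewrite fpsME big1 // => i _.
have [/ai->|lemi] := ltnP i m; first by rewrite mul0r.
by rewrite bi ?mulr0 // ltn_subLR ?leq_ord // (leq_trans lts) // leq_add2r.
Qed.

Let fps_mulf_eq0 a b : a * b = 0 -> (a == 0) || (b == 0).
Proof.
move=> ab0; apply/norP => -[/fps_ordP[ao ai] /fps_ordP[bo bi]].
have [+ _] := fpsM_lead ai bi; rewrite ab0 fps0E => /esym/eqP.
by rewrite mulf_eq0 (negbTE ao) (negbTE bo).
Qed.
HB.instance Definition _ := GRing.ComUnitRing_isIntegral.Build fps fps_mulf_eq0.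

Lemma fps_ordM a b : a != 0 -> b != 0 -> fps_ord (a * b) = (fps_ord a + fps_ord b)%N.
Proof.
move=> /fps_ordP[ao ai] /fps_ordP[bo bi]; have [abo abi] := fpsM_lead ai bi.
by apply: fps_ord_eq => //; rewrite abo mulf_neq0.
Qed.

Lemma fps_ord_geq a m : a != 0 -> (forall i, (i < m)%N -> a i = 0) -> (m <= fps_ord a)%N.
Proof.
move=> /fps_ordP[ao _] ai; rewrite leqNgt; apply: contraNN ao => /ai ->.
by rewrite eqxx.
Qed.

Lemma fps_ordD a b : a != 0 -> b != 0 -> a + b != 0 ->
  (minn (fps_ord a) (fps_ord b) <= fps_ord (a + b)%R)%N.
Proof.
move=> /fps_ordP[_ ai] /fps_ordP[_ bi] ab0; apply: fps_ord_geq => // i.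
by rewrite ltn_min fpsDE => /andP[/ai-> /bi->]; rewrite addr0.
Qed.

Definition fps_deriv a : fps := fun m => a m.+1 *+ m.+1.

Lemma fps_derivD a b : fps_deriv (a + b) = fps_deriv a + fps_deriv b.
Proof. by apply/fpsP => m; rewrite /fps_deriv !fpsDE mulrnDl. Qed.

Lemma fps_derivM a b :
  fps_deriv (a * b) = fps_deriv a * b + a * fps_deriv b.
Proof.
apply/fpsP => m; rewrite /fps_deriv fpsDE.
pose A := fps_trunc m.+2 a; pose B := fps_trunc m.+2 b.
have -> : (a * b) m.+1 = (A * B)`_m.+1 by rewrite -fps_mul_trunc.
rewrite -coef_deriv derivM coefD !coefM !fpsME; congr (_ + _).
  apply: eq_bigr => i _; rewrite coef_deriv !coef_poly !ltnS leqW ?leq_ord //.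
  by rewrite (leq_trans (leq_subr _ _)).
apply: eq_bigr => i _; rewrite coef_deriv !coef_poly !ltnS leq_subr.
by rewrite leqW ?leq_ord.
Qed.

Lemma fps_deriv_poly p : fps_deriv (fps_of_poly p) = fps_of_poly p^`().
Proof. by apply/fpsP => m; rewrite /fps_deriv /fps_of_poly coef_deriv. Qed.

Lemma fps_ord_deriv a : a != 0 -> fps_deriv a != 0 ->
  (fps_ord a <= (fps_ord (fps_deriv a)).+1)%N.
Proof.
move=> /fps_ordP[_ ai] da0; have := fps_ord_geq (m := (fps_ord a).-1) da0.
rewrite -[X in (X <= _.+1)%N]/(fps_ord a).
have [->//|o0] := eqVneq (fps_ord a) 0%N.
move=> H; rewrite -(prednK (_ : 0 < fps_ord a)%N) ?lt0n // ltnS; apply: H => i lti.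
by rewrite /fps_deriv ai ?mul0rn // -ltn_predRL.
Qed.

(* Hensel's lemma, solving for one coefficient at a time. *)
Lemma fps_nth_root n (h : fps) (g : F) : (n%:R : F) != 0 -> g != 0 -> g ^+ n = h 0%N ->
  exists2 y : fps, y ^+ n = h & y 0%N = g.
Proof.
move=> n0 g0 gn.
have n_gt0 : (0 < n)%N by rewrite lt0n; apply: contraNneq n0 => ->; rewrite mulr0n.
(* A Newton correction: as p has constant term g, adding u X^N with N > 0 changes the coefficient of
   X^N in p^n by u n g^(n-1). *)
pose step N p := p + ((h N - (p ^+ n)`_N) / (g ^+ n.-1 *+ n)) *: 'X^N.
pose P := fix P N := if N is N'.+1 then step N (P N') else g%:P.
pose y : fps := fun m => (P m)`_m.
have P_stable m N : (m <= N)%N -> (P N)`_m = y m.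
  elim: N => [|N IH]; first by rewrite leqn0 => /eqP->.
  rewrite leq_eqVlt => /predU1P[->//|]; rewrite ltnS => lemN.
  by rewrite -IH // /= coefD coefZ coefXn (ltn_eqF (_ : m < N.+1)%N) // mulr0 addr0.
have exp_stable k p q m : (forall i, (i <= m)%N -> p`_i = q`_i) -> (p ^+ k)`_m = (q ^+ k)`_m.
  move=> eqpq; suff: forall i, (i <= m)%N -> (p ^+ k)`_i = (q ^+ k)`_i by apply.
  elim: k => [//|k IH] i leim; rewrite !exprS !coefM; apply: eq_bigr => s _.
  have lesi : (s <= i)%N by rewrite leq_ord.
  by rewrite eqpq ?IH // ?(leq_trans lesi) // (leq_trans (leq_subr _ _)).
have yX k m : (y ^+ k) m = ((P m) ^+ k)`_m.
  transitivity (((fps_trunc m.+1 y) ^+ k)`_m); last first.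
    by apply: exp_stable => i leim; rewrite coef_poly ltnS leim P_stable.
  suff: forall i, (i <= m)%N -> (y ^+ k) i = ((fps_trunc m.+1 y) ^+ k)`_i by apply.
  elim: k => [//|k IH] i leim; rewrite !exprS coefM fpsME; apply: eq_bigr => s _.
  have lesi : (s <= i)%N by rewrite leq_ord.
  rewrite IH ?(leq_trans (leq_subr _ _)) // coef_poly ltnS.
  by rewrite (leq_trans lesi).
exists y; last by rewrite /y /= coefC.
apply/fpsP => m; rewrite yX.
case: m => [|m]; first by rewrite /= -rmorphXn /= coefC gn.
set N := m.+1; rewrite [P _]/(step N (P m)) /step; set u := (_ / _).
have P0 : (P m)`_0 = g by rewrite P_stable // /y /= coefC.
(* Terms of the binomial expansion containing u X^N at least twice start in degree 2N > N. *)
have -> : ((P m + u *: 'X^N) ^+ n)`_N = ((P m) ^+ n)`_N + u * (g ^+ n.-1 *+ n).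
  rewrite exprDn -(prednK n_gt0) !big_ord_recl /= subn0 expr0 mulr1 bin0 mulr1n.
  rewrite coefD; congr (_ + _).
  rewrite coefD [X in _ + X]coef_sum [X in _ + X]big1 ?addr0 => [|i _].
    rewrite /bump /= bin1 expr1 coefMn subSS subn0 -scalerAr coefZ coefMXn ltnn subnn.
    rewrite mulrnAr; congr (_ * _ *+ _).
    have -> : forall k, ((P m) ^+ k)`_0 = g ^+ k; last by [].
    by elim=> [|k IH]; rewrite ?expr0 ?coef1 // !exprS coef0M IH P0.
  rewrite coefMn exprZn -exprM -scalerAr coefZ coefMXn /bump /=.
  have -> : (N < N * (1 + (1 + i)))%N by rewrite -[ltnLHS]muln1 ltn_pmul2l.
  by rewrite mulr0 mul0rn.
rewrite /u divfK; first by rewrite addrC subrK.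
by rewrite -mulr_natr mulf_neq0 // expf_neq0.
Qed.

End PowerSeries.

(** * Valuations and Laurent series *)

Section Valuation.
Variables (K : fieldType) (v : K -> int).
Implicit Types f g : K.

(* The value at 0 is irrelevant. *)
Definition is_valuation :=
  (forall f g, f != 0 -> g != 0 -> v (f * g) = v f + v g) /\
  (forall f g, f != 0 -> g != 0 -> f + g != 0 -> Num.min (v f) (v g) <= v (f + g)).

Hypothesis v_val : is_valuation.

Lemma valuationM f g : f != 0 -> g != 0 -> v (f * g) = v f + v g.
Proof. exact: v_val.1. Qed.

Lemma valuation1 : v 1 = 0.
Proof.
have /eqP := valuationM (oner_neq0 K) (oner_neq0 K).
by rewrite mulr1 -subr_eq subrr => /eqP.
Qed.

Lemma valuationV f : f != 0 -> v f^-1 = - v f.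
Proof.
move=> f0; have := valuationM f0 (_ : f^-1 != 0).
by rewrite divff // valuation1 invr_eq0 f0 => /(_ isT); lia.
Qed.

Lemma valuationX f m : f != 0 -> v (f ^+ m) = v f *+ m.
Proof.
move=> f0; elim: m => [|m IH]; first by rewrite valuation1.
by rewrite exprS valuationM ?expf_neq0 // IH mulrS.
Qed.

Lemma valuation_prod (I : finType) (G : I -> K) : (forall i, G i != 0) ->
  v (\prod_i G i) = \sum_i v (G i).
Proof.
move=> G0; suff [] : \prod_i G i != 0 /\ v (\prod_i G i) = \sum_i v (G i) by [].
apply: (big_ind2 (fun x y => x != 0 /\ v x = y)); first by rewrite oner_neq0 valuation1.
  by move=> x a y b [x0 <-] [y0 <-]; rewrite mulf_neq0 // valuationM.
by [].
Qed.

(** As [v 0] is arbitrary, the first disjunct supplies the convention that 0 has infinite order. *)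
Definition val_ge (m : int) f := f = 0 \/ m <= v f.

Lemma val_geD m f g : val_ge m f -> val_ge m g -> val_ge m (f + g).
Proof.
move=> mf mg; have [->|fg0] := eqVneq (f + g) 0; first by left.
case: mf fg0 => [->|mf]; first by rewrite add0r.
case: mg => [->|mg fg0]; first by rewrite addr0; right.
have [f0|f0] := eqVneq f 0; first by rewrite f0 add0r; right.
have [g0|g0] := eqVneq g 0; first by rewrite g0 addr0; right.
by right; apply: le_trans (v_val.2 f g f0 g0 fg0); rewrite le_min mf.
Qed.

Lemma val_ge_sum m (I : Type) (r : seq I) (G : I -> K) :
  (forall i, val_ge m (G i)) -> val_ge m (\sum_(i <- r) G i).
Proof. by move=> mG; apply: big_ind => //; [left|apply: val_geD]. Qed.

Lemma val_geM m l f g : val_ge m f -> val_ge l g -> val_ge (m + l) (f * g).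
Proof.
move=> [->|mf]; first by rewrite mul0r; left.
move=> [->|lg]; first by rewrite mulr0; left.
have [->|f0] := eqVneq f 0; first by rewrite mul0r; left.
have [->|g0] := eqVneq g 0; first by rewrite mulr0; left.
by right; rewrite valuationM // lerD.
Qed.

Lemma valuationN f : f != 0 -> v (- f) = v f.
Proof.
move=> f0; have N0 : (-1 : K) != 0 by rewrite oppr_eq0 oner_eq0.
rewrite -mulN1r valuationM //.
by have := valuationM N0 N0; rewrite mulrNN mulr1 valuation1; lia.
Qed.

Lemma val_geN m f : val_ge m f -> val_ge m (- f).
Proof.
have [->|f0] := eqVneq f 0; first by rewrite oppr0.
by move=> [/eqP|mf]; [rewrite (negbTE f0)|right; rewrite valuationN].
Qed.

Lemma val_geW m l f : m <= l -> val_ge l f -> val_ge m f.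
Proof. by move=> lemf [->|lf]; [left|right; apply: le_trans lf]. Qed.

(** The ultrametric inequality gives one direction; the other comes from f = (f + g) - g, since g
    has larger order than f. *)
Lemma valuationD_lt f g : f != 0 -> val_ge (v f + 1) g -> f + g != 0 /\ v (f + g) = v f.
Proof.
move=> f0 [->|lt]; first by rewrite addr0.
have [->|g0] := eqVneq g 0; first by rewrite addr0.
have fg0 : f + g != 0.
  apply: contraTneq lt => /eqP; rewrite addrC addr_eq0 => /eqP->.
  by rewrite valuationN //; lia.
split=> //; apply/le_anti; apply/andP; split; last first.
  by apply: le_trans (v_val.2 f g f0 g0 fg0); rewrite le_min; lia.
have Ng0 : - g != 0 by rewrite oppr_eq0.
have := v_val.2 (f + g) (- g) fg0 Ng0; rewrite addrK valuationN // => /(_ f0).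
by rewrite ge_min => /orP[//|]; lia.
Qed.

End Valuation.

Lemma fps_fracP F (f : {fraction fps F}) :
  exists a b, b != 0 /\ f = FracField.tofrac a / FracField.tofrac b.
Proof.
elim/quotW: f => x; exists \n_x, \d_x; split; first exact: denom_ratioP.
have d0 : @FracField.tofrac _ \d_x != 0 by rewrite tofrac_eq0 denom_ratioP.
rewrite -[LHS](mulfK d0); congr (_ / _).
unlock FracField.tofrac; rewrite -[LHS]FracField.pi_mul /FracField.mulf.
apply/eqmodP; rewrite /= FracField.equivfE !numden_Ratio ?mulr1 ?mul1r ?oner_eq0
  ?denom_ratioP //.
by rewrite mulrC.
Qed.

(** * The field of Laurent series, as fractions of power series *)

Section Laurent.
Variables (F : fieldType) (L : fieldType) (frac : {rmorphism fps F -> L}).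
Hypothesis frac_inj : injective frac.
Hypothesis fracP : forall f : L, exists a b, b != 0 /\ f = frac a / frac b.
Implicit Types (f g : L) (a b : fps F).

Let frac_eq0 a : (frac a == 0) = (a == 0).
Proof. by rewrite -(inj_eq frac_inj) rmorph0. Qed.

Definition laurent_num f : fps F := sval (cid (fracP f)).
Definition laurent_den f : fps F := sval (cid (svalP (cid (fracP f)))).

Lemma laurent_den_neq0 f : laurent_den f != 0.
Proof. by have [] := svalP (cid (svalP (cid (fracP f)))). Qed.

Lemma laurent_numden f : f = frac (laurent_num f) / frac (laurent_den f).
Proof. by have [] := svalP (cid (svalP (cid (fracP f)))). Qed.

Lemma laurent_num_eq0 f : (laurent_num f == 0) = (f == 0).
Proof.
rewrite [in RHS](laurent_numden f) mulf_eq0 invr_eq0 !frac_eq0.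
by rewrite (negbTE (laurent_den_neq0 f)) orbF.
Qed.

Definition laurent_val f : int :=
  (fps_ord (laurent_num f))%:Z - (fps_ord (laurent_den f))%:Z.

Lemma laurent_val_ratio a b : a != 0 -> b != 0 ->
  laurent_val (frac a / frac b) = (fps_ord a)%:Z - (fps_ord b)%:Z.
Proof.
move=> a0 b0; set f := _ / _; rewrite /laurent_val.
have d0 := laurent_den_neq0 f.
have n0 : laurent_num f != 0 by rewrite laurent_num_eq0 mulf_neq0 ?invr_eq0 ?frac_eq0.
have /eqP := laurent_numden f; rewrite eqr_div ?frac_eq0 // -!rmorphM (inj_eq frac_inj).
by move=> /eqP /(congr1 (@fps_ord F)); rewrite !fps_ordM //; lia.
Qed.

Lemma laurent_val_frac a : a != 0 -> laurent_val (frac a) = (fps_ord a)%:Z.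
Proof.
move=> a0; rewrite -[frac a]divr1 -(rmorph1 frac) laurent_val_ratio ?oner_neq0 //.
have one0 : (1 : fps F) 0%N = 1 := coef1 F 0.
by rewrite (@fps_ord_eq _ 1 0%N) ?subr0 // one0 oner_eq0.
Qed.

Lemma laurent_valM f g : f != 0 -> g != 0 ->
  laurent_val (f * g) = laurent_val f + laurent_val g.
Proof.
move=> f0 g0; rewrite {1}(laurent_numden f) {1}(laurent_numden g) mulf_div -!rmorphM.
rewrite laurent_val_ratio ?mulf_neq0 ?laurent_num_eq0 ?laurent_den_neq0 //.
by rewrite !fps_ordM ?laurent_num_eq0 ?laurent_den_neq0 // /laurent_val; lia.
Qed.

Lemma laurent_valD f g : f != 0 -> g != 0 -> f + g != 0 ->
  Num.min (laurent_val f) (laurent_val g) <= laurent_val (f + g).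
Proof.
move=> f0 g0.
pose a := laurent_num f * laurent_den g; pose b := laurent_num g * laurent_den f.
pose c := laurent_den f * laurent_den g.
have c0 : c != 0 by rewrite mulf_neq0 ?laurent_den_neq0.
have a0 : a != 0 by rewrite mulf_neq0 ?laurent_den_neq0 ?laurent_num_eq0.
have b0 : b != 0 by rewrite mulf_neq0 ?laurent_den_neq0 ?laurent_num_eq0.
have fE : f = frac a / frac c.
  rewrite {1}(laurent_numden f) !rmorphM -mulf_div divff ?mulr1 //.
  by rewrite frac_eq0 laurent_den_neq0.
have gE : g = frac b / frac c.
  rewrite {1}(laurent_numden g) !rmorphM [frac (laurent_den f) * _]mulrC -mulf_div.
  by rewrite divff ?mulr1 // frac_eq0 laurent_den_neq0.
rewrite fE gE -mulrDl -rmorphD mulf_eq0 frac_eq0 negb_or => /andP[ab0 _].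
by rewrite !laurent_val_ratio // ge_min !lerD2r !lez_nat -geq_min fps_ordD.
Qed.

Lemma laurent_is_valuation : is_valuation laurent_val.
Proof. by split; [apply: laurent_valM|apply: laurent_valD]. Qed.
Let lv := laurent_is_valuation.

Lemma laurent_ge_frac a : val_ge laurent_val 0 (frac a).
Proof.
have [->|a0] := eqVneq a 0; first by left; rewrite rmorph0.
by right; rewrite laurent_val_frac.
Qed.

Definition laurent_cst : F -> L := frac \o @fps_of_poly F \o polyC.
HB.instance Definition _ := GRing.RMorphism.on laurent_cst.

(** In positive order c = 0 works. A series of order 0 is a / b with a and b of the same order; c is
    the quotient of their lowest coefficients, so that a - c b vanishes to higher order than b. *)
Lemma laurent_residue f : val_ge laurent_val 0 f ->
  exists c, val_ge laurent_val 1 (f - laurent_cst c).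
Proof.
have [->|f0] := eqVneq f 0; first by exists 0; left; rewrite rmorph0 subrr.
move=> [/eqP|vf]; first by rewrite (negbTE f0).
have [v1|v1] := leP 1 (laurent_val f); first by exists 0; right; rewrite rmorph0 subr0.
have a0 : laurent_num f != 0 by rewrite laurent_num_eq0.
have b0 := laurent_den_neq0 f.
set a := laurent_num f in a0; set b := laurent_den f in b0.
have [ao ai] := fps_ordP a0; have [bo bi] := fps_ordP b0.
have eqo : fps_ord a = fps_ord b.
  by move: vf v1; rewrite /laurent_val -/a -/b; lia.
exists (a (fps_ord b) / b (fps_ord b)); set c := (_ / _).
have -> : f - laurent_cst c = frac (a - fps_of_poly c%:P * b) / frac b.
  rewrite {1}(laurent_numden f) -/a -/b (rmorphB frac) (rmorphM frac) mulrBl mulfK //.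
  by rewrite frac_eq0.
set w := _ - _; have [->|w0] := eqVneq w 0; first by left; rewrite rmorph0 mul0r.
right; rewrite laurent_val_ratio // lerBrDr -PoszD lez_nat; apply: fps_ord_geq => // i.
have cM m : (fps_of_poly c%:P * b) m = c * b m.
  rewrite fpsME big_ord_recl /= subn0 /fps_of_poly coefC /= big1 ?addr0 // => s _.
  by rewrite coefC mul0r.
rewrite add1n ltnS leq_eqVlt => /orP[/eqP->|lti].
  by rewrite /w fpsDE fpsNE cM /c divfK // subrr.
by rewrite /w fpsDE fpsNE cM bi // ai ?eqo // mulr0 subrr.
Qed.

(** The quotient rule for f = a / b, in the form (a' - f b') / b, applied to the chosen numerator
    and denominator. *)
Definition laurent_deriv f :=
  (frac (fps_deriv (laurent_num f)) - f * frac (fps_deriv (laurent_den f)))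
    / frac (laurent_den f).

(** The derivative does not depend on the chosen fraction: if f = c / d = a / b, then c b = a d, and
    it suffices to differentiate this identity and to substitute c = f d and a = f b. *)
Lemma laurent_derivE f a b : b != 0 -> f * frac b = frac a ->
  laurent_deriv f = (frac (fps_deriv a) - f * frac (fps_deriv b)) / frac b.
Proof.
move=> b0 fb; rewrite /laurent_deriv; set c := laurent_num f; set d := laurent_den f.
have d0 : d != 0 := laurent_den_neq0 f.
have Fd0 : frac d != 0 by rewrite frac_eq0.
have Fb0 : frac b != 0 by rewrite frac_eq0.
have fd : f * frac d = frac c by rewrite {1}(laurent_numden f) divfK.
have : frac (fps_deriv (c * b)) = frac (fps_deriv (a * d)).
  suff -> : c * b = a * d by [].
  by apply/eqP; rewrite -(inj_eq frac_inj) !rmorphM -fb -fd; apply/eqP; ring.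
rewrite !fps_derivM !rmorphD !rmorphM -fb -fd => /eqP.
rewrite -subr_eq0 => /eqP E; apply/eqP; rewrite eqr_div // -subr_eq0 -E.
by apply/eqP; ring.
Qed.

Lemma laurent_deriv_frac a : laurent_deriv (frac a) = frac (fps_deriv a).
Proof.
rewrite (@laurent_derivE _ a 1) ?oner_eq0 ?rmorph1 ?mulr1 // divr1.
by rewrite -[1]/(fps_of_poly 1) fps_deriv_poly derivC !rmorph0 mulr0 subr0.
Qed.

Lemma laurent_derivM f g :
  laurent_deriv (f * g) = f * laurent_deriv g + g * laurent_deriv f.
Proof.
have b0 := laurent_den_neq0 f; have d0 := laurent_den_neq0 g.
have Fb0 : frac (laurent_den f) != 0 by rewrite frac_eq0.
have Fd0 : frac (laurent_den g) != 0 by rewrite frac_eq0.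
have fb : f * frac (laurent_den f) = frac (laurent_num f).
  by rewrite {1}(laurent_numden f) divfK.
have gd : g * frac (laurent_den g) = frac (laurent_num g).
  by rewrite {1}(laurent_numden g) divfK.
rewrite (@laurent_derivE _ (laurent_num f * laurent_num g)
  (laurent_den f * laurent_den g)) ?mulf_neq0 //; last first.
  by rewrite !rmorphM -fb -gd; ring.
rewrite !fps_derivM !rmorphD !rmorphM /laurent_deriv -fb -gd.
by field; rewrite ?Fb0 ?Fd0.
Qed.

Lemma laurent_derivD f g : laurent_deriv (f + g) = laurent_deriv f + laurent_deriv g.
Proof.
have b0 := laurent_den_neq0 f; have d0 := laurent_den_neq0 g.
have Fb0 : frac (laurent_den f) != 0 by rewrite frac_eq0.
have Fd0 : frac (laurent_den g) != 0 by rewrite frac_eq0.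
have fb : f * frac (laurent_den f) = frac (laurent_num f).
  by rewrite {1}(laurent_numden f) divfK.
have gd : g * frac (laurent_den g) = frac (laurent_num g).
  by rewrite {1}(laurent_numden g) divfK.
rewrite (@laurent_derivE _ (laurent_num f * laurent_den g + laurent_num g * laurent_den f)
  (laurent_den f * laurent_den g)) ?mulf_neq0 //; last first.
  by rewrite rmorphD !rmorphM -fb -gd; ring.
rewrite fps_derivD !fps_derivM !rmorphD !rmorphM /laurent_deriv -fb -gd.
by field; rewrite ?Fb0 ?Fd0.
Qed.

Lemma laurent_deriv_cst c : laurent_deriv (laurent_cst c) = 0.
Proof. by rewrite laurent_deriv_frac fps_deriv_poly derivC !rmorph0. Qed.

Lemma laurent_ge_deriv1 m f :
  val_ge laurent_val m f -> val_ge laurent_val (m - 1) (laurent_deriv f).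
Proof.
have [->|f0] := eqVneq f 0.
  by left; rewrite -{1}(rmorph0 laurent_cst) laurent_deriv_cst.
move=> [/eqP|vf]; first by rewrite (negbTE f0).
apply: val_geW (_ : _ <= laurent_val f - 1) _; first by rewrite lerD2r.
have deriv_ge a : a != 0 -> val_ge laurent_val ((fps_ord a)%:Z - 1) (frac (fps_deriv a)).
  move=> a0; have [->|da0] := eqVneq (fps_deriv a) 0; first by left; rewrite rmorph0.
  by right; rewrite laurent_val_frac //; have := fps_ord_deriv a0 da0; lia.
have a0 : laurent_num f != 0 by rewrite laurent_num_eq0.
have b0 := laurent_den_neq0 f.
rewrite /laurent_deriv.
apply: (@val_geW L laurent_val _
  (((fps_ord (laurent_num f))%:Z - 1) - (fps_ord (laurent_den f))%:Z)).
  by rewrite /laurent_val; lia.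
apply: (val_geM lv); last first.
  by right; rewrite (valuationV lv) ?frac_eq0 // laurent_val_frac.
apply: (val_geD lv); first exact: deriv_ge.
apply: (val_geN lv); apply: (@val_geW L laurent_val _
  (laurent_val f + ((fps_ord (laurent_den f))%:Z - 1))).
  by rewrite /laurent_val; lia.
by apply: (val_geM lv); [right|apply: deriv_ge].
Qed.

(** Subtracting the residue, a constant, makes the order at least 1, and differentiation lowers it
    by at most 1. *)
Lemma laurent_ge_deriv f : val_ge laurent_val 0 f -> val_ge laurent_val 0 (laurent_deriv f).
Proof.
move=> /laurent_residue[c]; rewrite -[f](subrK (laurent_cst c)) addrK => fc.
by rewrite laurent_derivD laurent_deriv_cst addr0; apply: laurent_ge_deriv1 fc.
Qed.

Lemma laurent_poly_val0 (p : {poly F}) : p`_0 != 0 ->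
  frac (fps_of_poly p) != 0 /\ laurent_val (frac (fps_of_poly p)) = 0.
Proof.
move=> p0; have P0 : fps_of_poly p != 0.
  by apply: contraNneq p0 => /fpsP/(_ 0%N); rewrite fps0E => /eqP.
by rewrite frac_eq0 laurent_val_frac // (@fps_ord_eq _ _ 0%N).
Qed.

Lemma laurent_val_var :
  frac (fps_of_poly 'X) != 0 /\ laurent_val (frac (fps_of_poly 'X)) = 1.
Proof.
have X1 : fps_of_poly ('X : {poly F}) 1%N = 1 by rewrite /fps_of_poly coefX.
have X0 : fps_of_poly ('X : {poly F}) != 0.
  by apply/eqP => /fpsP/(_ 1%N)/eqP; rewrite X1 fps0E oner_eq0.
rewrite frac_eq0 laurent_val_frac // (@fps_ord_eq _ _ 1%N) ?X1 ?oner_neq0 //.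
by case=> // _; rewrite /fps_of_poly coefX.
Qed.

Lemma laurent_nth_root n (p : {poly F}) (g : F) : (n%:R : F) != 0 -> g != 0 ->
  g ^+ n = p`_0 -> exists y, [/\ y != 0, laurent_val y = 0 & y ^+ n = frac (fps_of_poly p)].
Proof.
move=> n0 g0 gp; have [y yp y0] := fps_nth_root n0 g0 (h := fps_of_poly p) gp.
have Y0 : y != 0 by apply: contraNneq g0 => Y0; rewrite -y0 Y0 fps0E.
exists (frac y); rewrite frac_eq0 -yp rmorphXn; split=> //.
by rewrite laurent_val_frac // (@fps_ord_eq _ _ 0%N) ?y0.
Qed.

End Laurent.

(** The properties of Laurent series in the local parameter [lpoly 'X] on which the later arguments
    rest; the construction by fractions stays hidden behind them. *)
Record laurent_field (F : fieldType) := LaurentField {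
  lfield :> fieldType;
  lpoly : {rmorphism {poly F} -> lfield};
  lval : lfield -> int;
  lderiv : lfield -> lfield;
  lval_valuation : is_valuation lval;
  lpoly_ge : forall p, val_ge lval 0 (lpoly p);
  lpoly_val0 : forall p : {poly F}, p`_0 != 0 -> lpoly p != 0 /\ lval (lpoly p) = 0;
  lval_var : lpoly 'X != 0 /\ lval (lpoly 'X) = 1;
  lderivD : forall f g, lderiv (f + g) = lderiv f + lderiv g;
  lderivM : forall f g, lderiv (f * g) = f * lderiv g + g * lderiv f;
  lderiv_poly : forall p, lderiv (lpoly p) = lpoly p^`();
  lderiv_ge : forall f, val_ge lval 0 f -> val_ge lval 0 (lderiv f);
  lnth_root : forall n (p : {poly F}) (g : F), (n%:R : F) != 0 -> g != 0 ->
    g ^+ n = p`_0 -> exists y, [/\ y != 0, lval y = 0 & y ^+ n = lpoly p]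
}.

Lemma laurent_field_exists (F : fieldType) : inhabited (laurent_field F).
Proof.
pose frac := @FracField.tofrac (fps F).
have frac_inj : injective frac by move=> a b /eqP; rewrite tofrac_eq => /eqP.
pose fracP := @fps_fracP F.
constructor; apply: (@LaurentField F {fraction fps F} (frac \o @fps_of_poly F)
  (@laurent_val F _ frac fracP) (@laurent_deriv F _ frac fracP)).
- exact: laurent_is_valuation.
- by move=> p; apply: laurent_ge_frac.
- exact: laurent_poly_val0.
- exact: laurent_val_var.
- exact: laurent_derivD.
- exact: laurent_derivM.
- by move=> p; rewrite laurent_deriv_frac // fps_deriv_poly.
- exact: laurent_ge_deriv.
- exact: laurent_nth_root.
Qed.

(** * Normal forms in the function field of the cover *)

Section Expi.
Variable R : realType.
Implicit Types t s : R.

Lemma expiD t s : expi (t + s) = expi t * expi s.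
Proof.
rewrite /expi cosD sinD; apply/eqP; rewrite eq_complex /=.
by rewrite eqxx /=; apply/eqP; ring.
Qed.

Lemma expi0 : expi (0 : R) = 1.
Proof. by rewrite /expi cos0 sin0. Qed.

Lemma expiMn t m : expi (t *+ m) = expi t ^+ m.
Proof. by elim: m => [|m IH]; rewrite ?mulr0n ?expi0 // mulrS exprS expiD IH. Qed.

(** For 0 < i < n put t = pi i / n, which lies in (0, pi); then cos (2t) = 1 - 2 (sin t)^2 < 1, so
    the i-th power is not 1. *)
Lemma expi_prim n : (0 < n)%N -> n.-primitive_root (expi (2 * pi / n%:R : R)).
Proof.
move=> n_gt0; have nR0 : (n%:R : R) != 0 by rewrite pnatr_eq0 -lt0n.
have pi0 := pi_gt0 R.
have En m : expi (2 * pi / n%:R) ^+ m = expi (2 * pi * m%:R / n%:R : R).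
  by rewrite -expiMn -[_ *+ m]mulr_natr mulrAC.
rewrite /primitive_root_of_unity n_gt0; apply/forallP => i.
rewrite unity_rootE En; apply/eqP; have [->|neq] := eqVneq i.+1 n.
  by rewrite mulfK // /expi mulrC mulr_natr cos2pi sin2pi eqxx.
have lti : (i.+1 < n)%N by rewrite ltn_neqAle neq ltn_ord.
apply/negbTE; rewrite eq_complex /= negb_and; apply/orP; left.
pose t : R := pi * i.+1%:R / n%:R.
have -> : 2 * pi * i.+1%:R / n%:R = t *+ 2 by rewrite -[RHS]mulr_natl /t !mulrA.
have st : 0 < sin t.
  apply: sin_gt0_pi; rewrite /t ltr_pdivrMr ?ltr0n // ltr_pM2l // ltr_nat lti.
  by rewrite divr_gt0 ?mulr_gt0 ?ltr0n.
rewrite cos_mulr2n -subr_eq0 neq_lt; apply/orP; left.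
by rewrite cos2sin2; have := mulr_gt0 st st; rewrite expr2; lra.
Qed.

End Expi.

Section H1.
Variables n k : nat.

Lemma delta_lift (i : 'I_k) : delta n (lift ord0 i) = delta_mx 0 i.
Proof. by rewrite /delta liftK. Qed.

(** Closure under opposites need not be checked: coefficients in Z/n are represented by natural
    numbers, so every element is a sum of generators. *)
Lemma H1_ind (P : H1 n k -> Prop) :
    P 0 -> (forall u v, P u -> P v -> P (u + v)) ->
    (forall i, P (delta n (lift ord0 i))) ->
  forall u, P u.
Proof.
move=> P0 PD Pdelta u; rewrite [u](row_sum_delta u); apply: big_ind => // i _.
rewrite -[u 0 i]natr_Zp scaler_nat -delta_lift.
by elim: (u 0 i : nat) => [|m IH]; rewrite ?mulr0n // mulrS; apply: PD.
Qed.

End H1.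

Section PolyEval.
Variables (F K : fieldType) (c : {rmorphism F -> K}) (x : K).

Definition peval : {poly F} -> K := horner_eval x \o map_poly c.
HB.instance Definition _ := GRing.RMorphism.on peval.

Lemma pevalC a : peval a%:P = c a.
Proof. by rewrite /peval /= map_polyC /horner_eval hornerC. Qed.

Lemma pevalX : peval 'X = x.
Proof. by rewrite /peval /= map_polyX /horner_eval hornerX. Qed.

Lemma peval_morph (K' : fieldType) (f : {rmorphism K -> K'}) (c' : {rmorphism F -> K'}) p :
  (forall a, f (c a) = c' a) -> f (peval p) = (map_poly c' p).[f x].
Proof.
move=> fc; rewrite /peval /= /horner_eval -horner_map -map_poly_comp.
by congr _.[_]; apply: eq_map_poly => a /=.
Qed.

End PolyEval.

Lemma primitive_pow_inj (F : fieldType) n (z : F) (i j : 'I_n) :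
  n.-primitive_root z -> z ^+ i = z ^+ j -> i = j.
Proof.
move=> zn /eqP; rewrite (eq_prim_root_expr zn) !modn_small // => /eqP.
exact: val_inj.
Qed.

(* A pair (f, g) below consists of the values of one and the same normal form at
   two solutions of the equations of the cover, in fields K1 and K2. *)
Section NormalForm.
Variables (F : fieldType) (n k : nat) (b : 'I_k -> F).
Hypothesis n_gt0 : (0 < n)%N.

Local Notation exps := {ffun 'I_k -> 'I_n}.

Section Model.
Variables (K : fieldType) (c : {rmorphism F -> K}) (x : K) (z : 'I_k -> K).

Definition monom (e : 'I_k -> nat) : K := \prod_i z i ^+ e i.
Definition nf_eval (p : exps -> {poly F}) : K := \sum_e peval c x (p e) * monom (fun i => e i).

Lemma monom_gen i : monom (fun i' => i' == i) = z i.
Proof.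
rewrite /monom (bigD1 i) //= eqxx expr1 big1 ?mulr1 // => i' /negbTE->.
by rewrite expr0.
Qed.

Lemma nf_eval_single e q :
  nf_eval (fun e' => if e' == e then q else 0) = peval c x q * monom (fun i => e i).
Proof.
rewrite /nf_eval (bigD1 e) //= eqxx big1 ?addr0 // => d /negbTE->.
by rewrite rmorph0 mul0r.
Qed.

Hypothesis zn : forall i, z i ^+ n = x - c (b i).

Lemma monomD (e e' : 'I_k -> nat) : monom e * monom e' = monom (fun i => e i + e' i)%N.
Proof. by rewrite /monom -big_split; apply: eq_bigr => i _; rewrite exprD. Qed.

(** Each z_i^n is replaced by x - b_i, which brings the exponents below n at the cost of a
    polynomial factor in x. *)
Lemma monom_reduce (e : 'I_k -> nat) :
  monom e = peval c x (\prod_i ('X - (b i)%:P) ^+ (e i %/ n)) * monom (fun i => e i %% n)%N.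
Proof.
rewrite rmorph_prod -big_split; apply: eq_bigr => i _.
rewrite rmorphXn rmorphB /= pevalX pevalC -zn -exprM -exprD mulnC.
by rewrite {1}(divn_eq (e i) n) mulnC.
Qed.

End Model.

Variables (K1 : fieldType) (c1 : {rmorphism F -> K1}) (x1 : K1) (z1 : 'I_k -> K1).
Variables (K2 : fieldType) (c2 : {rmorphism F -> K2}) (x2 : K2) (z2 : 'I_k -> K2).
Hypothesis z1n : forall i, z1 i ^+ n = x1 - c1 (b i).
Hypothesis z2n : forall i, z2 i ^+ n = x2 - c2 (b i).

Definition integral_pair (f : K1) (g : K2) :=
  exists p : exps -> {poly F}, f = nf_eval c1 x1 z1 p /\ g = nf_eval c2 x2 z2 p.

Lemma integral_pairD f g f' g' :
  integral_pair f g -> integral_pair f' g' -> integral_pair (f + f') (g + g').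
Proof.
move=> [p [-> ->]] [p' [-> ->]]; exists (fun e => p e + p' e); split.
  by rewrite /nf_eval -big_split; apply: eq_bigr => e _; rewrite rmorphD mulrDl.
by rewrite /nf_eval -big_split; apply: eq_bigr => e _; rewrite rmorphD mulrDl.
Qed.

Lemma integral_pair0 : integral_pair 0 0.
Proof. by exists (fun=> 0); rewrite /nf_eval !big1 // => e _; rewrite rmorph0 mul0r. Qed.

Lemma integral_pair_monom p e :
  integral_pair (peval c1 x1 p * monom z1 e) (peval c2 x2 p * monom z2 e).
Proof.
pose e' : exps := [ffun i => Ordinal (ltn_pmod (e i) n_gt0)].
pose q := p * \prod_i ('X - (b i)%:P) ^+ (e i %/ n).
exists (fun e'' => if e'' == e' then q else 0).
rewrite !nf_eval_single (monom_reduce z1n) (monom_reduce z2n) !mulrA -!rmorphM.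
by split; congr (_ * _); apply: eq_bigr => i _; rewrite ffunE.
Qed.

Lemma integral_pairM f g f' g' :
  integral_pair f g -> integral_pair f' g' -> integral_pair (f * f') (g * g').
Proof.
move=> [p [-> ->]] [p' [-> ->]]; rewrite /nf_eval !big_distrlr /=.
have pair_sum (I : finType) (G1 : I -> K1) (G2 : I -> K2) :
    (forall i, integral_pair (G1 i) (G2 i)) -> integral_pair (\sum_i G1 i) (\sum_i G2 i).
  by move=> G; apply: big_rec2; [apply: integral_pair0|move=> i *; apply: integral_pairD].
apply: (pair_sum) => e; apply: pair_sum => e'.
rewrite ![_ * monom _ _ * _]mulrACA !monomD -!rmorphM.
exact: integral_pair_monom.
Qed.

Lemma integral_pair_poly p : integral_pair (peval c1 x1 p) (peval c2 x2 p).
Proof.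
have := integral_pair_monom p (fun=> 0%N).
by rewrite /monom !big1 ?mulr1.
Qed.

Lemma integral_pair_gen i : integral_pair (z1 i) (z2 i).
Proof.
have := integral_pair_monom 1 (fun i' => i' == i).
by rewrite !rmorph1 !mul1r !monom_gen.
Qed.

(** Normal forms with a common denominator q(x). This relation is the graph of the embedding to be
    constructed. *)
Definition nf_pair (f : K1) (g : K2) :=
  exists2 q, q != 0 & integral_pair (f * peval c1 x1 q) (g * peval c2 x2 q).

Lemma nf_pairD f g f' g' : nf_pair f g -> nf_pair f' g' -> nf_pair (f + f') (g + g').
Proof.
move=> [q q0 fg] [q' q'0 fg']; exists (q * q'); rewrite ?mulf_neq0 //.
rewrite (rmorphM (peval c1 x1)) (rmorphM (peval c2 x2)) !mulrDl; apply: integral_pairD.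
  by rewrite !mulrA; apply: integral_pairM fg (integral_pair_poly q').
rewrite [peval c1 x1 q * _]mulrC [peval c2 x2 q * _]mulrC !mulrA.
exact: integral_pairM fg' (integral_pair_poly q).
Qed.

Lemma nf_pairM f g f' g' : nf_pair f g -> nf_pair f' g' -> nf_pair (f * f') (g * g').
Proof.
move=> [q q0 fg] [q' q'0 fg']; exists (q * q'); rewrite ?mulf_neq0 //.
rewrite (rmorphM (peval c1 x1)) (rmorphM (peval c2 x2)) mulrACA [g * _ * _]mulrACA.
exact: integral_pairM.
Qed.

Lemma integral_nf_pair f g : integral_pair f g -> nf_pair f g.
Proof. by move=> fg; exists 1; rewrite ?oner_neq0 // !rmorph1 !mulr1. Qed.

Lemma nf_pair_cst a : nf_pair (c1 a) (c2 a).
Proof. by apply: integral_nf_pair; have := integral_pair_poly a%:P; rewrite !pevalC. Qed.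

Lemma nf_pairB f g f' g' : nf_pair f g -> nf_pair f' g' -> nf_pair (f - f') (g - g').
Proof.
move=> fg fg'; rewrite -![- _ as X in _ + X]mulN1r; apply: nf_pairD fg _.
by apply: nf_pairM fg'; rewrite -(rmorphN1 c1) -(rmorphN1 c2); apply: nf_pair_cst.
Qed.

End NormalForm.

(* Applying [a t - lam e0 t] to a vanishing sum removes the term of index e0. *)
Lemma eigenvectors_independent (I : finType) (K : fieldType) (T : Type)
    (a : T -> {rmorphism K -> K}) (lam : I -> T -> K) (v : I -> K) :
    (forall t t' e, a t (lam e t') = lam e t') ->
    (forall e e', e != e' -> exists t, lam e t != lam e' t) ->
    (forall t e, a t (v e) = lam e t * v e) ->
  \sum_e v e = 0 -> forall e, v e = 0.
Proof.
move=> alam sep av sum0.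
suff main (S : {set I}) (w : I -> K) : (forall t e, a t (w e) = lam e t * w e) ->
    \sum_(e in S) w e = 0 -> forall e, e \in S -> w e = 0.
  move=> e; apply: (main [set: I] v) => //.
  by rewrite -[RHS]sum0; apply: eq_bigl => e'; rewrite inE.
have [m] := ubnP #|S|; elim: m S w => // m IH S w leSm aw w0.
have other e0 e : e0 \in S -> e \in S -> e != e0 -> w e = 0.
  move=> e0S eS nee0; have [t /negbTE net] := sep _ _ nee0.
  pose w' e := (lam e t - lam e0 t) * w e.
  have /eqP : w' e = 0.
    apply: (IH (S :\ e0) w'); last by rewrite !inE nee0.
    - by rewrite (cardsD1 e0) e0S in leSm.
    - by move=> t' e'; rewrite /w' rmorphM rmorphB !alam aw mulrCA.
    have -> : \sum_(e' in S :\ e0) w' e' = \sum_(e' in S) w' e'.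
      by rewrite [RHS](big_setD1 e0) //= /w' subrr mul0r add0r.
    transitivity (a t (\sum_(e' in S) w e') - lam e0 t * \sum_(e' in S) w e').
      rewrite rmorph_sum mulr_sumr -sumrB; apply: eq_bigr => e' _.
      by rewrite aw /w' mulrBl.
    by rewrite w0 rmorph0 mulr0 subrr.
  by rewrite mulf_eq0 subr_eq0 net => /eqP.
move=> e eS; rewrite (bigD1 e) //= big1 ?addr0 // in w0 => e' /andP[e'S nee'].
exact: other e'S nee'.
Qed.

(** * Galois action on normal forms, and embeddings of the function field *)

Section CoverField.
Variables (R : realType) (n k : nat) (b : 'I_k -> R[i]) (X : abelian_cover n b).
Variable act : H1 n k -> {rmorphism X -> X}.
Hypotheses (n_gt0 : (0 < n)%N) (hact : galois_action act).

Local Notation C := R[i].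
Local Notation zeta := (expi (2 * pi / n%:R : R)).
Local Notation ev := (peval (cst X) (xfun X)).
Local Notation exps := {ffun 'I_k -> 'I_n}.

Lemma ev_eq0 q : (ev q == 0) = (q == 0).
Proof.
apply/idP/idP => [evq|/eqP->]; last by rewrite rmorph0.
by apply: contraT => q0; case: (@xfun_transcendental _ _ _ _ X); exists q.
Qed.

Lemma zfun_ev i : zfun X i ^+ n = ev ('X - (b i)%:P).
Proof. by rewrite zfun_eq rmorphB /= pevalX pevalC. Qed.

Lemma zfun_neq0 i : zfun X i != 0.
Proof.
have : ev ('X - (b i)%:P) != 0 by rewrite ev_eq0 polyXsubC_eq0.
by rewrite -zfun_ev expf_eq0 n_gt0.
Qed.

Lemma monom_neq0 e : monom (zfun X) e != 0.
Proof. by apply/prodf_neq0 => i _; rewrite expf_neq0 ?zfun_neq0. Qed.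

Lemma act_ev u p : act u (ev p) = ev p.
Proof.
have [_ _ actc actx _] := hact.
by rewrite (peval_morph _ _ (actc u)) actx.
Qed.

Lemma act_delta_monom i e : act (delta n (lift ord0 i)) (monom (zfun X) e) =
  cst X (zeta ^+ e i) * monom (zfun X) e.
Proof.
have [_ _ _ _ actz] := hact.
rewrite /monom rmorph_prod (bigD1 i) //= [in RHS](bigD1 i) //= !rmorphXn /= actz eqxx.
rewrite exprMn -mulrA; congr (_ * (_ * _)).
by apply: eq_bigr => j /negbTE neji; rewrite rmorphXn /= actz neji.
Qed.

(** Uniqueness of the normal form. Exponents below n are separated by the powers of the primitive
    root zeta, so the summands are eigenvectors for distinct characters; each of them vanishes, and
    x is transcendental. *)
Lemma nf_eval_eq0 (p : exps -> {poly C}) :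
  nf_eval (cst X) (xfun X) (zfun X) p = 0 -> forall e, p e = 0.
Proof.
move=> p0 e; apply/eqP; rewrite -ev_eq0.
suff /eqP : ev (p e) * monom (zfun X) (fun i => e i) = 0.
  by rewrite mulf_eq0 (negbTE (monom_neq0 _)) orbF.
apply: (eigenvectors_independent (I := exps) (T := 'I_k)
  (a := fun i => act (delta n (lift ord0 i))) (lam := fun (e : exps) i => cst X (zeta ^+ e i))
  (v := fun e => ev (p e) * monom (zfun X) (fun i => e i))) => //.
- by have [_ _ actc _ _] := hact; move=> *; apply: actc.
- move=> e1 e2 nee'; apply: contrapT => noti; case/eqP: nee'; apply/ffunP => i.
  apply: (primitive_pow_inj (expi_prim R n_gt0)); apply: (fmorph_inj (cst X)).
  by apply/eqP; apply: contrapT => nei; apply: noti; exists i; apply/negP.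
by move=> i e'; rewrite rmorphM act_ev act_delta_monom mulrCA.
Qed.

Lemma act_delta_nf_eval i p :
  act (delta n (lift ord0 i)) (nf_eval (cst X) (xfun X) (zfun X) p) =
  nf_eval (cst X) (xfun X) (zfun X) (fun e : exps => (zeta ^+ e i)%:P * p e).
Proof.
rewrite rmorph_sum; apply: eq_bigr => e _.
by rewrite (rmorphM ev) /= pevalC rmorphM act_ev act_delta_monom mulrCA mulrA.
Qed.

(** Applying the action of the i-th generator minus [lam i] multiplies the coefficient of exponent e
    by zeta^(e_i) - lam_i and gives 0, so uniqueness of the normal form applies. *)
Lemma nf_eval_eigen (p : exps -> {poly C}) (lam : 'I_k -> C) :
    (forall i, act (delta n (lift ord0 i)) (nf_eval (cst X) (xfun X) (zfun X) p) =
       cst X (lam i) * nf_eval (cst X) (xfun X) (zfun X) p) ->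
  forall (e : exps) i, zeta ^+ e i != lam i -> p e = 0.
Proof.
move=> actp e i nee.
have /nf_eval_eq0/(_ e)/eqP : nf_eval (cst X) (xfun X) (zfun X)
    (fun e : exps => (zeta ^+ e i - lam i)%:P * p e) = 0.
  transitivity (act (delta n (lift ord0 i)) (nf_eval (cst X) (xfun X) (zfun X) p) -
      cst X (lam i) * nf_eval (cst X) (xfun X) (zfun X) p).
    rewrite act_delta_nf_eval mulr_sumr -sumrB; apply: eq_bigr => e' _.
    rewrite polyCB mulrBl (rmorphB ev) mulrBl [in LHS](rmorphM ev (lam i)%:P) /=.
    by rewrite pevalC mulrA.
  by rewrite actp subrr.
by rewrite mulf_eq0 polyC_eq0 subr_eq0 (negbTE nee) => /eqP.
Qed.

Section Extension.
Variables (L : fieldType) (c : {rmorphism C -> L}) (x0 : L) (w : 'I_k -> L).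
Hypothesis wn : forall i, w i ^+ n = x0 - c (b i).
Hypothesis x0_transc : forall q, q != 0 -> peval c x0 q != 0.

Let zE := @zfun_eq _ _ _ _ X.
Local Notation pair := (@nf_pair _ n k X (cst X) (xfun X) (zfun X) L c x0 w).

(** As pairs can be subtracted, this makes the relation single-valued. *)
Lemma nf_pair_eq0 y : pair 0 y -> y = 0.
Proof.
move=> [q q0 [p []]]; rewrite mul0r => /esym/nf_eval_eq0 p0 /eqP.
rewrite /nf_eval big1 => [|e _]; last by rewrite p0 rmorph0 mul0r.
by rewrite mulf_eq0 (negbTE (x0_transc q0)) orbF => /eqP.
Qed.

(** The conjugates of f are used to form its norm. A generator multiplies coefficients by powers of
    zeta, and the same change can be made in L, where no Galois action is given. *)
Lemma nf_pair_act u f y : pair f y -> exists y', pair (act u f) y'.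
Proof.
have [act0 actD _ _ _] := hact.
elim/H1_ind: u f y => [f y|u v IHu IHv f y /IHv[y' /IHu]|i f y [q q0 [p [fq _]]]].
- by rewrite act0; exists y.
- by rewrite actD.
pose p' e := (zeta ^+ (e : exps) i)%:P * p e.
exists (nf_eval c x0 w p' / peval c x0 q); exists q => //; exists p'.
rewrite divfK ?x0_transc //; split=> //.
by rewrite -act_delta_nf_eval -fq rmorphM act_ev.
Qed.

(** The norm argument: if g is the product of the other conjugates of f, then f g is Galois
    invariant, hence of the form p(x) / q(x), and f^-1 = g q(x) / p(x) is obtained by products
    alone. *)
Lemma nf_pairV f y : pair f y -> pair f^-1 y^-1.
Proof.
have [act0 actD _ _ _] := hact.
have [-> /nf_pair_eq0->|f0 fy] := eqVneq f 0.
  by rewrite !invr0 -(rmorph0 c) -(rmorph0 (cst X)); apply: (nf_pair_cst n_gt0 zE wn).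
pose g := \prod_(u | u != 0) act u f.
have [w' gw] : exists w', pair g w'.
  apply: (big_ind (fun g1 => exists w1, pair g1 w1)) => [|g1 g2 [w1 gw1] [w2 gw2]|u _].
  - by exists 1; rewrite -(rmorph1 c) -(rmorph1 (cst X)); apply: (nf_pair_cst n_gt0 zE wn).
  - by exists (w1 * w2); apply: (nf_pairM n_gt0 zE wn).
  - exact: nf_pair_act fy.
have fgE : f * g = \prod_u act u f by rewrite (bigD1 0) //= act0.
have fg0 : f * g != 0.
  by rewrite fgE; apply/prodf_neq0 => u _; rewrite fmorph_eq0.
have fg_inv v : act v (f * g) = f * g.
  rewrite fgE rmorph_prod [RHS](reindex_inj (addrI v)) /=.
  by apply: eq_bigr => u _; rewrite -actD.
have [q q0 [p [fgq ywq]]] := nf_pairM n_gt0 zE wn fy gw.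
have inv1 i : act (delta n (lift ord0 i)) (nf_eval (cst X) (xfun X) (zfun X) p) =
       cst X 1 * nf_eval (cst X) (xfun X) (zfun X) p.
  by rewrite rmorph1 mul1r -fgq rmorphM fg_inv act_ev.
pose e0 : exps := [ffun=> Ordinal n_gt0].
(* Invariance leaves only the term with all exponents 0. *)
have pE e : e != e0 -> p e = 0.
  move=> nee; apply: contrapT => pe; case/eqP: nee; apply/ffunP => i.
  apply: (primitive_pow_inj (expi_prim R n_gt0)); rewrite ffunE expr0.
  apply/eqP; apply: contrapT => /negP nei; apply: pe.
  exact: (nf_eval_eigen inv1 nei).
have nfE (K : fieldType) (c' : {rmorphism C -> K}) x' z' :
    nf_eval c' x' z' p = peval c' x' (p e0).
  rewrite /nf_eval (bigD1 e0) //= big1 => [|e /pE->]; last by rewrite rmorph0 mul0r.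
  rewrite addr0 /monom big1 ?mulr1 // => i _.
  by rewrite ffunE expr0.
rewrite nfE in fgq; rewrite nfE in ywq.
have p0 : p e0 != 0.
  by rewrite -ev_eq0 -fgq mulf_neq0 ?ev_eq0.
have p0L := x0_transc p0.
have pairq : pair (ev q / ev (p e0)) (peval c x0 q / peval c x0 (p e0)).
  exists (p e0) => //; rewrite !divfK ?ev_eq0 //.
  exact: (integral_pair_poly n_gt0 zE wn).
have := nf_pairM n_gt0 zE wn gw pairq.
have -> : g * (ev q / ev (p e0)) = f^-1.
  rewrite -fgq; have g0 : g != 0 by move: fg0; rewrite mulf_eq0 negb_or => /andP[].
  have q0' : ev q != 0 by rewrite ev_eq0.
  by field; rewrite f0 g0 q0'.
have -> : w' * (peval c x0 q / peval c x0 (p e0)) = y^-1.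
  move: p0L; rewrite -ywq !mulf_eq0 !negb_or => /andP[/andP[y0 w0] qL].
  by field; rewrite y0 w0 qL.
by [].
Qed.

(** The functions that have a partner form a subfield containing the constants, x and the z_i, which
    generate the function field. *)
Lemma nf_pair_total f : exists y, pair f y.
Proof.
pose S := [pred f | `[< exists y, pair f y >]].
have [S1 SB SV] : divring_closed S.
  split.
  - apply/asboolP; exists 1; rewrite -(rmorph1 c) -(rmorph1 (cst X)).
    exact: (nf_pair_cst n_gt0 zE wn).
  - move=> g h /asboolP[y gy] /asboolP[y' hy]; apply/asboolP; exists (y - y').
    exact: (nf_pairB n_gt0 zE wn).
  - move=> g h /asboolP[y gy] /asboolP[y' hy]; apply/asboolP; exists (y / y').
    by apply: (nf_pairM n_gt0 zE wn gy (nf_pairV hy)).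
have Sdiv : divring_closed S by [].
pose Sc : divringClosed X := HB.pack (S : X -> bool) (GRing.isDivringClosed.Build X S Sdiv).
suff : f \in Sc by move/asboolP.
apply: (@fct_generated _ _ _ _ X Sc) => [a||i]; apply/asboolP.
- by exists (c a); apply: (nf_pair_cst n_gt0 zE wn).
- exists x0; apply: integral_nf_pair.
  by have := integral_pair_poly n_gt0 zE wn 'X; rewrite !pevalX.
- by exists (w i); apply: integral_nf_pair; apply: (integral_pair_gen n_gt0 zE wn).
Qed.

(** The relation is total, single-valued and compatible with sums and products, so it is the graph
    of a field embedding. *)
Lemma cover_hom : exists phi : {rmorphism X -> L},
  [/\ forall a, phi (cst X a) = c a, phi (xfun X) = x0 & forall i, phi (zfun X i) = w i].
Proof.
pose phi f := sval (cid (nf_pair_total f)).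
have phiP f : pair f (phi f) by rewrite /phi; case: cid.
have phi_eq f y : pair f y -> phi f = y.
  move=> fy; apply/eqP; rewrite -subr_eq0; apply/eqP/nf_pair_eq0.
  by rewrite -(subrr f); apply: (nf_pairB n_gt0 zE wn).
have phiB : zmod_morphism phi by move=> f g; apply: phi_eq; apply: (nf_pairB n_gt0 zE wn).
have phiM : monoid_morphism phi.
  split=> [|f g]; apply: phi_eq; last exact: (nf_pairM n_gt0 zE wn).
  by rewrite -(rmorph1 c) -(rmorph1 (cst X)); apply: (nf_pair_cst n_gt0 zE wn).
pose phi_mor : {rmorphism X -> L} := HB.pack phi
  (GRing.isZmodMorphism.Build X L phi phiB) (GRing.isMonoidMorphism.Build X L phi phiM).
exists phi_mor; split=> [a||i]; apply: phi_eq.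
- exact: (nf_pair_cst n_gt0 zE wn).
- apply: integral_nf_pair.
  by have := integral_pair_poly n_gt0 zE wn 'X; rewrite !pevalX.
- by apply: integral_nf_pair; apply: (integral_pair_gen n_gt0 zE wn).
Qed.

End Extension.
End CoverField.

(** * Points of the curve *)

(* A copy of L carrying the K-module structure given by phi. *)
Definition along (K L : fieldType) (phi : {rmorphism K -> L}) : Type := L.

Section Along.
Variables (K L : fieldType) (phi : {rmorphism K -> L}).

Local Notation along := (along phi).
HB.instance Definition _ := GRing.Zmodule.copy along L.
Definition along_scale (f : K) (y : along) : along := phi f * (y : L).
Let along_scaleA f g y : along_scale f (along_scale g y) = along_scale (f * g) y.
Proof. by rewrite /along_scale rmorphM mulrA. Qed.
Let along_scale1 : left_id 1 along_scale.
Proof. by move=> y; rewrite /along_scale rmorph1 mul1r. Qed.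
Let along_scaleDr : right_distributive along_scale +%R.
Proof. by move=> f y y'; rewrite /along_scale -mulrDr. Qed.
Let along_scaleDl y : {morph along_scale^~ y : f g / f + g}.
Proof. by move=> f g; rewrite /along_scale rmorphD mulrDl. Qed.
HB.instance Definition _ := GRing.Zmodule_isLmodule.Build K along
  along_scaleA along_scale1 along_scaleDr along_scaleDl.

End Along.

Section ClosedPoly.
Variables (F : closedFieldType) (K : fieldType) (c : {rmorphism F -> K}) (x : K).
Hypothesis x_transc : forall r, x - c r != 0.

(** Over an algebraically closed field q splits into linear factors, so transcendence of x only has
    to be tested against constants. *)
Lemma peval_neq0 q : q != 0 -> peval c x q != 0.
Proof.
move=> q0; have [rs ->] := closed_field_poly_normal q.
rewrite -mul_polyC (rmorphM (peval c x)) /= pevalC mulf_neq0 //.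
  by rewrite fmorph_eq0 lead_coef_eq0.
rewrite (rmorph_prod (peval c x)) prodf_seq_neq0; apply/allP => r _ /=.
by rewrite (rmorphB (peval c x)) /= pevalX pevalC.
Qed.

Lemma peval_val (v : K -> int) (m : int) q : is_valuation v ->
    (forall a, a != 0 -> v (c a) = 0) -> (forall r, v (x - c r) = m) ->
  q != 0 -> v (peval c x q) = m *+ (size q).-1.
Proof.
move=> vval vc vm q0; have [rs qE] := closed_field_poly_normal q.
have prod_neq0 s : \prod_(r <- s) (x - c r) != 0.
  by rewrite prodf_seq_neq0; apply/allP => r _; rewrite /= x_transc.
have -> : (size q).-1 = size rs.
  by rewrite qE size_scale ?lead_coef_eq0 // size_prod_XsubC.
rewrite qE -mul_polyC (rmorphM (peval c x)) /= pevalC (rmorph_prod (peval c x)) /=.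
under eq_bigr do rewrite (rmorphB (peval c x)) /= pevalX pevalC.
rewrite (valuationM vval) ?fmorph_eq0 ?lead_coef_eq0 // vc ?lead_coef_eq0 // add0r.
elim: rs {qE} => [|r rs IH]; first by rewrite big_nil (valuation1 vval).
by rewrite big_cons (valuationM vval) // IH vm mulrS.
Qed.

End ClosedPoly.

Lemma peval_lpoly (F : fieldType) (L : laurent_field F) (p q : {poly F}) :
  peval (lpoly L \o polyC) (lpoly L p) q = lpoly L (q \Po p).
Proof.
rewrite /comp_poly /peval /= /horner_eval map_poly_comp.
by rewrite horner_map.
Qed.

Section Place.
Variables (R : realType) (n k : nat) (b : 'I_k -> R[i]) (X : abelian_cover n b).
Variable act : H1 n k -> {rmorphism X -> X}.
Hypotheses (n_gt0 : (0 < n)%N) (hact : galois_action act).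
Local Notation C := R[i].
Variable L : laurent_field C.
Local Notation ev := (peval (cst X) (xfun X)).
Local Notation cL := (lpoly L \o polyC).

Let lv := lval_valuation L.

Lemma lcst_neq0 (a : C) : (cL a == 0) = (a == 0).
Proof. exact: fmorph_eq0. Qed.

Lemma lcst_val (a : C) : a != 0 -> lval (cL a) = 0.
Proof. by move=> a0; have [] := @lpoly_val0 _ L a%:P; rewrite ?coefC. Qed.

(** Here phi is the expansion of functions at P in a local parameter. *)
Definition is_place (phi : {rmorphism X -> L}) (P : curve_point X) :=
  (forall a, phi (cst X a) = cL a) /\ (forall f, P f = lval (phi f)).

Lemma place_of_hom (phi : {rmorphism X -> L}) : (forall a, phi (cst X a) = cL a) ->
  (exists2 t, t != 0 & lval (phi t) = 1) -> exists P, is_place phi P.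
Proof.
move=> phic ht.
have phi0 f : f != 0 -> phi f != 0 by rewrite fmorph_eq0.
unshelve eexists (@CurvePoint _ _ _ _ _ (fun f => lval (phi f)) _ _ _ ht) => //.
- by move=> f g f0 g0 /=; rewrite rmorphM lv.1 ?phi0.
- by move=> f g f0 g0 fg0 /=; rewrite rmorphD lv.2 -?rmorphD ?phi0.
- by move=> a a0 /=; rewrite phic lcst_val.
Qed.

Lemma place_ev phi P q : is_place phi P -> phi (ev q) = peval cL (phi (xfun X)) q.
Proof. by move=> [phic _]; apply: peval_morph. Qed.

Lemma place_monom (phi : {rmorphism X -> L}) (e : 'I_k -> nat) :
  lval (phi (monom (zfun X) e)) = \sum_i lval (phi (zfun X i)) *+ e i.
Proof.
have z0 i : phi (zfun X i) != 0 by rewrite fmorph_eq0 (zfun_neq0 X n_gt0).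
rewrite rmorph_prod (valuation_prod lv) => [|i]; last by rewrite rmorphXn expf_neq0.
by apply: eq_bigr => i _; rewrite rmorphXn (valuationX lv).
Qed.

Section Differential.
Variables (Om : lmodType X) (d : X -> Om) (hd : kaehler d).
Variables (phi : {rmorphism X -> L}) (P : curve_point X).
Hypothesis phiP : is_place phi P.

(** The universal property of d, applied to the derivation that sends f to the derivative of its
    expansion. *)
Lemma place_form : exists psi : {linear Om -> along phi},
  forall f g, psi (f *: d g) = (phi f * lderiv (phi g) : L).
Proof.
have [|psi [psid _]] := hd.2 (along phi) (fun f => lderiv (phi f) : L).
  split=> [f g|f g|a].
  - by rewrite rmorphD lderivD.
  - by rewrite rmorphM lderivM.
  by rewrite phiP.1 lderiv_poly derivC rmorph0.
by exists psi => f g; rewrite linearZ /= psid.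
Qed.

Lemma place_d_neq0 f : lderiv (phi f) != 0 -> d f != 0.
Proof.
have [psi psiE] := place_form; apply: contraNneq => df0.
have := psiE 1 f; rewrite scale1r df0 linear0 rmorph1 mul1r => e.
by apply/eqP; rewrite -e.
Qed.

Lemma place_regular f g : regular_at d P (f *: d g) ->
  val_ge (@lval _ L) 0 (phi f * lderiv (phi g)).
Proof.
have [psi psiE] := place_form; rewrite -psiE => -[m [F [G [FG ->]]]].
rewrite linear_sum /=; apply: (val_ge_sum lv) => i; rewrite psiE.
have reg h : regular_fun P h -> val_ge (@lval _ L) 0 (phi h).
  by case=> [->|]; [left; rewrite rmorph0|rewrite phiP.2; right].
have [/reg Fi /reg Gi] := FG i.
by rewrite -[0]addr0; apply: (val_geM lv) => //; apply: lderiv_ge.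
Qed.

End Differential.

(** The ramification index of x at the points over a. *)
Definition ram (a : C) : nat := if [exists i, b i == a] then n else 1.

Lemma ram_gt0 a : (0 < ram a)%N.
Proof. by rewrite /ram; case: ifP. Qed.

Lemma lval_Xn m : lpoly L 'X^m != 0 /\ lval (lpoly L 'X^m) = m.
Proof.
have [X0 X1] := lval_var L.
by rewrite rmorphXn expf_neq0 // (valuationX lv) // X1 natz.
Qed.

Lemma lderiv_Xn m : (0 < m)%N -> 
  lderiv (lpoly L 'X^m) = lpoly L 'X^(m.-1) * cL m%:R.
Proof.
by move=> m0; rewrite lderiv_poly derivXn -mulr_natr rmorphM /= polyC_natr.
Qed.

Lemma natC_neq0 m : (0 < m)%N -> (m%:R : C) != 0.
Proof. by rewrite pnatr_eq0 -lt0n. Qed.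

(** In a local parameter t the point is given by x = a + t^e with e = [ram a], z_i = t if b_i = a,
    and otherwise z_i an n-th root of the unit a - b_i + t^e. *)
Lemma finite_place (a : C) : exists phi P, [/\ is_place phi P,
  phi (xfun X) = lpoly L (a%:P + 'X^(ram a)),
  forall i, lval (phi (zfun X i)) = (b i == a)%:R &
  lderiv (phi (xfun X)) != 0 /\ lval (lderiv (phi (xfun X))) = (ram a).-1 ].
Proof.
set e := ram a; have e_gt0 : (0 < e)%N := ram_gt0 a.
pose x0 := lpoly L (a%:P + 'X^e).
have dx0 : lderiv x0 = lpoly L 'X^(e.-1) * cL e%:R.
  by rewrite /x0 rmorphD lderivD lderiv_Xn // lderiv_poly derivC rmorph0 add0r.
have [Xe0 Xe] := lval_Xn e.-1.
have e0 : cL e%:R != 0 by rewrite lcst_neq0 natC_neq0.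
(* Constants have derivative 0, whereas [x0] has derivative e t^(e-1), which is nonzero in
   characteristic 0. *)
have x0_transc r : x0 - cL r != 0.
  apply/eqP => /eqP; rewrite subr_eq0 => /eqP xr.
  have /eqP : lderiv x0 = 0 by rewrite xr lderiv_poly derivC rmorph0.
  by rewrite dx0 mulf_eq0 (negbTE Xe0) (negbTE e0).
have z_root i : exists y : L, [/\ y != 0, lval y = (b i == a)%:R & y ^+ n = x0 - cL (b i)].
  rewrite /x0 /= -rmorphB addrAC -polyCB.
  have [bia|nbia] := eqVneq (b i) a.
    have -> : e = n by rewrite /e /ram; case: existsP => // -[]; exists i; rewrite bia.
    have [X0 X1] := lval_var L; exists (lpoly L 'X); split=> //.
    by rewrite bia subrr add0r rmorphXn.
  pose g := n.-root (a - b i); have gn : g ^+ n = a - b i by apply: rootCK.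
  apply: (@lnth_root _ L n _ g); first exact: natC_neq0.
    by rewrite rootC_eq0 // subr_eq0 eq_sym.
  by rewrite coefD coefC coefXn (ltn_eqF e_gt0) addr0.
pose w i := sval (cid (z_root i)).
have wP i : [/\ w i != 0, lval (w i) = (b i == a)%:R & w i ^+ n = x0 - cL (b i)].
  by rewrite /w; case: cid.
have [||phi [phic phix phiz]] := @cover_hom _ _ _ _ X act n_gt0 hact L cL x0 w.
- by move=> i; have [] := wP i.
- exact: peval_neq0.
have [|P phiP] := place_of_hom phic.
  (* A function of order 1 is z_i over b_i, and x - a over the other values. *)
  have [[i bia]|nb] := pselect (exists i, b i == a).
    exists (zfun X i); first exact: (zfun_neq0 X n_gt0).
    by rewrite phiz; have [_ -> _] := wP i; rewrite bia.
  have e1 : e = 1%N by rewrite /e /ram; case: existsP.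
  have xa : phi (xfun X - cst X a) = lpoly L 'X.
    by rewrite rmorphB phic phix -rmorphB addrC addKr e1.
  exists (xfun X - cst X a); last by rewrite xa; have [] := lval_var L.
  by rewrite -(fmorph_eq0 phi) xa; have [] := lval_var L.
exists phi, P; rewrite phix dx0 mulf_neq0 // (valuationM lv) // Xe lcst_val ?natC_neq0 //.
by split=> // [i|]; [rewrite phiz; have [] := wP i|rewrite addr0].
Qed.

(** The point is given by x = b_{i0} + t^(-n) and z_i = t^(-1) y_i, where y_i is the n-th root of 1
    + (b_{i0} - b_i) t^n with constant term 1. *)
Lemma infinite_place (i0 : 'I_k) : exists phi P, [/\ is_place phi P,
  forall r, lval (phi (xfun X) - cL r) = - n%:Z /\ phi (xfun X) - cL r != 0,
  forall i, lval (phi (zfun X i)) = -1 &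
  lderiv (phi (xfun X)) != 0 /\ lval (lderiv (phi (xfun X))) = - n%:Z - 1 ].
Proof.
have [t0 t1] := lval_var L; set t := lpoly L 'X in t0 t1.
have [tn0 tn] := lval_Xn n; set tn_ := lpoly L 'X^n in tn0 tn.
pose x0 := cL (b i0) + tn_^-1.
have x0E r : x0 - cL r = tn_^-1 * lpoly L (1 + (b i0 - r)%:P * 'X^n).
  rewrite /x0 rmorphD rmorph1 rmorphM /= polyCB rmorphB mulrDr mulr1 [_ * tn_]mulrC.
  by rewrite mulKf // addrAC addrC.
have coef0 r : (1 + (b i0 - r)%:P * 'X^n)`_0 = 1.
  by rewrite coefD coef1 coefMXn n_gt0 addr0.
have x0_val r : lval (x0 - cL r) = - n%:Z /\ x0 - cL r != 0.
  have [|u0 uv] := @lpoly_val0 _ L (1 + (b i0 - r)%:P * 'X^n).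
    by rewrite coef0 oner_neq0.
  rewrite x0E mulf_neq0 ?invr_eq0 // (valuationM lv) ?invr_eq0 //.
  by rewrite (valuationV lv) // tn uv addr0.
have z_root i : exists y : L, [/\ y != 0, lval y = -1 & y ^+ n = x0 - cL (b i)].
  have [|||y [y0 yv yn]] := @lnth_root _ L n (1 + (b i0 - b i)%:P * 'X^n) 1.
  - exact: natC_neq0.
  - exact: oner_neq0.
  - by rewrite coef0 expr1n.
  exists (t^-1 * y); rewrite mulf_neq0 ?invr_eq0 // (valuationM lv) ?invr_eq0 //.
  by rewrite (valuationV lv) // t1 yv addr0 exprMn exprVn yn x0E /tn_ rmorphXn.
pose w i := sval (cid (z_root i)).
have wP i : [/\ w i != 0, lval (w i) = -1 & w i ^+ n = x0 - cL (b i)].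
  by rewrite /w; case: cid.
have [||phi [phic phix phiz]] := @cover_hom _ _ _ _ X act n_gt0 hact L cL x0 w.
- by move=> i; have [] := wP i.
- by apply: peval_neq0 => r; have [] := x0_val r.
have [|P phiP] := place_of_hom phic.
  have [w0 wv _] := wP i0.
  exists (zfun X i0)^-1; first by rewrite invr_eq0 (zfun_neq0 X n_gt0).
  by rewrite fmorphV phiz (valuationV lv) // wv.
have dx0 : lderiv x0 = - (tn_^-1 * tn_^-1 * (lpoly L 'X^(n.-1) * cL n%:R)).
  have : lderiv (tn_ * tn_^-1) = 0.
    by rewrite divff // -(rmorph1 (lpoly L)) lderiv_poly derivC rmorph0.
  rewrite lderivM lderiv_Xn // => e.
  rewrite /x0 lderivD lderiv_poly derivC rmorph0 add0r.
  apply: (mulfI tn0); apply/eqP; rewrite -subr_eq0 -e; apply/eqP.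
  by field.
have [Xn0 Xn] := lval_Xn n.-1.
have n0 : cL n%:R != 0 by rewrite lcst_neq0 natC_neq0.
have tnV0 : tn_^-1 != 0 by rewrite invr_eq0.
exists phi, P; split=> // [r|i|]; rewrite ?phix //.
  by rewrite phiz; have [] := wP i.
rewrite dx0 oppr_eq0 !mulf_neq0 //; split=> //.
rewrite (valuationN lv) ?mulf_neq0 // !(valuationM lv) ?mulf_neq0 // (valuationV lv) // tn Xn.
by rewrite lcst_val ?natC_neq0 //; lia.
Qed.

End Place.

(** * Differential forms *)

Section Derivation.
Variables (R : realType) (n k : nat) (b : 'I_k -> R[i]) (X : abelian_cover n b).
Variables (V : lmodType X) (D : X -> V).
Hypothesis derD : derivation D.

Lemma derivation1 : D 1 = 0.
Proof. by have [_ _ Dc] := derD; rewrite -(rmorph1 (cst X)) Dc. Qed.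

Lemma derivationB f g : D (f - g) = D f - D g.
Proof.
have [DD DM Dc] := derD; apply/eqP; rewrite -subr_eq opprK addrC -DD.
by rewrite addrC subrK.
Qed.

Lemma derivation0 : D 0 = 0.
Proof. by rewrite -(subrr 1) derivationB subrr. Qed.

Lemma derivationX f m : D (f ^+ m) = (m%:R * f ^+ m.-1) *: D f.
Proof.
have [DD DM Dc] := derD; elim: m => [|m IH]; first by rewrite derivation1 mul0r scale0r.
rewrite exprS DM IH scalerA -scalerDl; congr (_ *: _).
case: m {IH} => [|m]; first by rewrite mul0r mulr0 add0r mul1r.
by rewrite /= mulrCA -exprS -[in RHS]natr1 mulrDl mul1r.
Qed.

Lemma derivationV f : D f^-1 = - (f ^- 2) *: D f.
Proof.
have [DD DM Dc] := derD; have [->|f0] := eqVneq f 0.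
  by rewrite invr0 derivation0 scaler0.
have /eqP := DM f f^-1; rewrite divff // derivation1 eq_sym addr_eq0 => /eqP fD.
rewrite -[LHS]scale1r -(mulVf f0) -scalerA fD scalerN scalerA scaleNr.
by rewrite -invfM.
Qed.

End Derivation.

Section Forms.
Variables (R : realType) (n k : nat) (b : 'I_k -> R[i]) (X : abelian_cover n b).
Variable act : H1 n k -> {rmorphism X -> X}.
Hypotheses (n_gt0 : (0 < n)%N) (hact : galois_action act).
Variables (Om : lmodType X) (d : X -> Om) (hd : kaehler d).
Local Notation C := R[i].
Local Notation x := (xfun X).
Local Notation z := (zfun X).
Local Notation ev := (peval (cst X) (xfun X)).

Let derd : derivation d := hd.1.

Lemma nat_neq0 m : (0 < m)%N -> (m%:R : X) != 0.
Proof. by move=> m0; rewrite -(rmorph_nat (cst X)) fmorph_eq0 pnatr_eq0 -lt0n. Qed.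

Lemma dxfun i : d x = (n%:R * z i ^+ n.-1) *: d (z i).
Proof.
have [_ _ dc] := derd.
by rewrite -derivationX // zfun_eq derivationB // dc subr0.
Qed.

(** At a point over x = 0 the expansion of x has nonzero derivative. *)
Lemma dxfun_neq0 : d x != 0.
Proof.
have [L] := laurent_field_exists C.
have [phi [P [phiP _ _ [dx0 _]]]] := finite_place n_gt0 hact L 0.
exact: (place_d_neq0 hd phiP dx0).
Qed.

(** By the rules for differences and quotients such f form a subfield. It contains z_i because dx =
    n z_i^(n-1) dz_i. *)
Lemma d_proportional f : exists r, d f = r *: d x.
Proof.
have [dD dM dc] := derd.
pose S := [pred f | `[< exists r, d f = r *: d x >]].
have Sdiv : divring_closed S.
  split.
  - by apply/asboolP; exists 0; rewrite scale0r derivation1.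
  - move=> g h /asboolP[r gr] /asboolP[s hs]; apply/asboolP; exists (r - s).
    by rewrite derivationB // gr hs scalerBl.
  - move=> g h /asboolP[r gr] /asboolP[s hs]; apply/asboolP.
    exists (g * (- (h ^- 2) * s) + h^-1 * r).
    by rewrite dM derivationV // gr hs !scalerA -scalerDl mulrA.
pose Sc : divringClosed X := HB.pack (S : X -> bool) (GRing.isDivringClosed.Build X S Sdiv).
suff : f \in Sc by move/asboolP.
apply: (@fct_generated _ _ _ _ X Sc) => [a||i]; apply/asboolP.
- by exists 0; rewrite dc scale0r.
- by exists 1; rewrite scale1r.
- exists (n%:R * z i ^+ n.-1)^-1; rewrite (dxfun i) scalerA mulVf ?scale1r //.
  by rewrite mulf_neq0 ?nat_neq0 // expf_neq0 // (zfun_neq0 X n_gt0).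
Qed.

(* [d f = r f *: d x] makes r a derivation, hence r factors through d by a linear
   phi; the uniqueness in the universal property of d gives
   [phi om *: d x = om]. *)
Lemma form_proportional (om : Om) : exists r, om = r *: d x.
Proof.
pose r f := sval (cid (d_proportional f)).
have rE f : d f = r f *: d x by rewrite /r; case: cid.
have dx_inj s t : s *: d x = t *: d x -> s = t.
  move/eqP; rewrite -subr_eq0 -scalerBl scaler_eq0 (negbTE dxfun_neq0) orbF subr_eq0.
  by move/eqP.
have [dD dM dc] := derd.
have der_r : derivation (r : X -> (X^o : lmodType X)).
  split=> [f g|f g|a]; apply: dx_inj; rewrite -?rE.
  - by rewrite scalerDl -!rE dD.
  - by rewrite dM (rE f) (rE g) !scalerA -scalerDl.
  - by rewrite dc scale0r.
have [phi [phid _]] := hd.2 _ _ der_r.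
have [psi [_ psi_uniq]] := hd.2 Om d derd.
pose mu (om : Om) : Om := (phi om : X) *: d x.
have mu_lin : linear mu.
  by move=> a u v; rewrite /mu linearP scalerDl scalerA.
pose mul : {linear Om -> Om} := HB.pack mu (GRing.isLinear.Build X Om Om *:%R mu mu_lin).
exists (phi om); rewrite -[RHS]/(mul om) (psi_uniq mul); last first.
  by move=> f; rewrite /= /mu phid -rE.
by rewrite -(psi_uniq idfun).
Qed.

(** * Forms in an eigenspace of the Galois group *)

Section Eigenforms.
Variables (pb : forall u : H1 n k, {linear Om -> Om | act u \; *:%R}).
Hypothesis hpb : is_pullback d pb.
Variables (chi : H1 n k -> C) (hchi : is_character chi) (j : 'I_k -> nat).
Local Notation zeta := (expi (2 * pi / n%:R : R)).
Hypotheses (j_gt0 : forall i, (0 < j i)%N) (j_lt : forall i, (j i < n)%N).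
Hypothesis chi_delta : forall i, chi (delta n (lift ord0 i)) = zeta ^+ j i.

Lemma scale_dxfun_eq0 r : (r *: d x == 0) = (r == 0).
Proof. by rewrite scaler_eq0 (negbTE dxfun_neq0) orbF. Qed.

Lemma pullback_dxfun u r : pb u (r *: d x) = act u r *: d x.
Proof. by have [_ _ _ actx _] := hact; rewrite linearZ /= hpb actx. Qed.

Lemma eigenform_generators r :
    (forall i, act (delta n (lift ord0 i)) r = cst X (zeta ^+ j i) * r) ->
  forall u, pb u (r *: d x) = cst X (chi u) *: (r *: d x).
Proof.
move=> ractE u; rewrite pullback_dxfun scalerA; congr (_ *: _).
have [act0 actD actc _ _] := hact; have [chi0 chiD] := hchi.
elim/H1_ind: u => [|u v IHu IHv|i]; last by rewrite ractE chi_delta.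
  by rewrite act0 chi0 rmorph1 mul1r.
by rewrite actD IHv rmorphM actc IHu chiD rmorphM mulrCA mulrA.
Qed.

(** The pole orders, in the z_i, of the basic eigenfunction; their sum is the M of the theorem. *)
Definition coexp i := (n - j i)%N.

(* In the paper's notation, the product of the z_i ^ (j_i - n). *)
Definition eigenfun : X := (monom z coexp)^-1.

Definition eigenform (p : {poly C}) : Om := (ev p * eigenfun) *: d x.

Lemma eigenfun_neq0 : eigenfun != 0.
Proof. by rewrite invr_eq0 monom_neq0. Qed.

Lemma act_eigenfun i p : act (delta n (lift ord0 i)) (ev p * eigenfun) =
  cst X (zeta ^+ j i) * (ev p * eigenfun).
Proof.
have zj : zeta ^+ coexp i * zeta ^+ j i = 1.
  by rewrite -exprD subnK ?(ltnW (j_lt i)) // (prim_expr_order (expi_prim R n_gt0)).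
rewrite rmorphM (act_ev hact) fmorphV (act_delta_monom hact) mulrCA; congr (_ * _).
rewrite invfM; congr (_ * _); rewrite -fmorphV; congr (cst X _).
have zc0 : zeta ^+ coexp i != 0.
  by apply: contra_eq_neq zj => ->; rewrite mul0r eq_sym oner_neq0.
by apply: (mulfI zc0); rewrite mulfV.
Qed.

Lemma eigenform_pullback p u : pb u (eigenform p) = cst X (chi u) *: eigenform p.
Proof. by apply: eigenform_generators => i; apply: act_eigenfun. Qed.

Lemma eigenform_sum N (c : 'I_N -> C) :
  \sum_(i < N) cst X (c i) *: eigenform 'X^i = eigenform (\sum_(i < N) c i *: 'X^i).
Proof.
rewrite /eigenform rmorph_sum /= mulr_suml scaler_suml; apply: eq_bigr => i _.
by rewrite scalerA -mul_polyC (rmorphM ev) /= pevalC mulrA.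
Qed.

Lemma eigenform_eq0 p : (eigenform p == 0) = (p == 0).
Proof.
by rewrite scale_dxfun_eq0 mulf_eq0 (negbTE eigenfun_neq0) orbF ev_eq0.
Qed.

(** This passes from the exponents j_i of normal forms to the exponents j_i - n of [eigenfun]. *)
Lemma monom_coexp : monom z j * monom z coexp = ev (\prod_i ('X - (b i)%:P)).
Proof.
rewrite (rmorph_prod ev) /monom -big_split; apply: eq_bigr => i _ /=.
by rewrite -exprD subnKC ?(ltnW (j_lt i)) // zfun_ev.
Qed.

Lemma normal_form f : exists2 q, q != 0 &
  exists p : {ffun 'I_k -> 'I_n} -> {poly C}, f * ev q = nf_eval (cst X) x z p.
Proof.
have [q q0|y [q q0 [p [fq _]]]] := nf_pair_total n_gt0 hact (@zfun_eq _ _ _ _ X) _ f.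
  by rewrite ev_eq0.
by exists q => //; exists p.
Qed.

(** Comparing eigenvalues, only the exponents e_i = j_i occur in the normal form of the coefficient
    of dx. Then z^j is rewritten by [monom_coexp], and the fraction is put in lowest terms. *)
Lemma eigenform_quotient om : (forall u, pb u om = cst X (chi u) *: om) ->
  exists p q, [/\ q != 0, coprimep p q & om = (ev p / ev q * eigenfun) *: d x].
Proof.
have [F ->] := form_proportional om => pbF.
have actF i : act (delta n (lift ord0 i)) F = cst X (zeta ^+ j i) * F.
  move/eqP: (pbF (delta n (lift ord0 i))); rewrite pullback_dxfun chi_delta.
  by rewrite scalerA -subr_eq0 -scalerBl scale_dxfun_eq0 subr_eq0 => /eqP.
have [q q0 [p Fq]] := normal_form F.
pose e : {ffun 'I_k -> 'I_n} := [ffun i => Ordinal (j_lt i)].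
have p0 e' : e' != e -> p e' = 0.
  move=> nee; apply: contrapT => pe; case/eqP: nee; apply/ffunP => i.
  apply: (primitive_pow_inj (expi_prim R n_gt0)); rewrite ffunE /=.
  apply/eqP; apply: contrapT => /negP nei; apply: pe.
  apply: (nf_eval_eigen n_gt0 hact _ nei) => i'.
  by rewrite -Fq rmorphM actF (act_ev hact) mulrA.
have {}Fq : F * ev q = ev (p e * \prod_i ('X - (b i)%:P)) * eigenfun.
  rewrite Fq /nf_eval (bigD1 e) //= big1 ?addr0 => [|e' /p0->]; last first.
    by rewrite rmorph0 mul0r.
  rewrite (rmorphM ev) /= -monom_coexp -mulrA mulfK ?monom_neq0 //.
  by congr (_ * _); apply: eq_bigr => i _; rewrite ffunE.
set P := p e * _ in Fq; pose g := gcdp P q.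
have g0 : g != 0 by rewrite gcdp_eq0 negb_and q0 orbT.
have qE : q = q %/ g * g by rewrite divpK ?dvdp_gcdr.
have PE : P = P %/ g * g by rewrite divpK ?dvdp_gcdl.
have q'0 : q %/ g != 0 by apply: contraNneq q0 => q'0; rewrite qE q'0 mul0r.
exists (P %/ g), (q %/ g); split=> //.
  by apply: coprimep_div_gcd; rewrite q0 orbT.
congr (_ *: _); apply: (@mulIf _ (ev q)); first by rewrite ev_eq0.
rewrite Fq {1}PE {2}qE !(rmorphM ev) /= -!mulrA; congr (_ * _).
have E1 : ev (q %/ g) != 0 by rewrite ev_eq0.
by rewrite [eigenfun * _]mulrCA mulKf // mulrC.
Qed.

Lemma holomorphic_eigenform om : (0 < k)%N -> holomorphic d om ->
    (forall u, pb u om = cst X (chi u) *: om) ->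
  exists2 p : {poly C}, (size p <= (\sum_i coexp i) %/ n)%N & om = eigenform p.
Proof.
move=> k_gt0 hol /eigenform_quotient[p [q [q0 cop omE]]].
have [L] := laurent_field_exists C; have lv := lval_valuation L.
have cop_root a : root q a -> p.[a] != 0.
  by move=> qa; apply: (coprimep_root (q := p) _ qa); rewrite coprimep_sym.
(* A root a of q would give a pole: at a point over a with ramification index e, p has order 0, q at
   least e, [eigenfun] at most 0 and dx exactly e - 1. *)
have size_q : size q == 1%N.
  apply/negPn/negP => /closed_rootP[a qa]; have pa := cop_root a qa.
  have p0 : p != 0 by apply: contraNneq pa => ->; rewrite horner0.
  have [phi [P [phiP phix phiz [dx0 dxv]]]] := finite_place n_gt0 hact L a.
  have lval_p : lval (phi (ev p)) = 0.
    rewrite (place_ev _ phiP) phix peval_lpoly.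
    have [|_ ->] := @lpoly_val0 _ L (p \Po (a%:P + 'X^(ram n b a))) => //.
    rewrite -horner_coef0 horner_comp hornerD hornerC hornerXn expr0n.
    by rewrite gtn_eqF ?ram_gt0 // addr0.
  have lval_q : (ram n b a)%:Z <= lval (phi (ev q)).
    have /factor_theorem[q1 q1E] := qa.
    have q10 : q1 != 0 by apply: contraNneq q0 => q10; rewrite q1E q10 mul0r.
    have XE : phi (ev ('X - a%:P)) = lpoly L 'X^(ram n b a).
      rewrite (place_ev _ phiP) phix peval_lpoly comp_polyB comp_polyX comp_polyC.
      by rewrite addrC addKr.
    have [Xn0 Xn] := lval_Xn L (ram n b a).
    rewrite q1E !rmorphM (valuationM lv) ?fmorph_eq0 ?ev_eq0 ?polyXsubC_eq0 // XE Xn.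
    suff : val_ge (@lval _ L) 0 (phi (ev q1)).
      by case=> [/eqP|]; [rewrite fmorph_eq0 ev_eq0 (negbTE q10)|rewrite lerDr].
    by rewrite (place_ev _ phiP) phix peval_lpoly; apply: lpoly_ge.
  have := hol P; rewrite omE => /(place_regular hd phiP) [/eqP|].
    rewrite mulf_eq0 (negbTE dx0) orbF fmorph_eq0 !mulf_eq0 invr_eq0 !ev_eq0.
    by rewrite (negbTE p0) (negbTE q0) (negbTE eigenfun_neq0).
  have ev0 r : r != 0 -> phi (ev r) != 0 by rewrite fmorph_eq0 ev_eq0.
  have mon0 : phi (monom z coexp) != 0 by rewrite fmorph_eq0 monom_neq0.
  rewrite /eigenfun !rmorphM !fmorphV !(valuationM lv) ?mulf_neq0 ?invr_eq0 ?ev0 //.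
  rewrite !(valuationV lv) ?ev0 // lval_p dxv (place_monom n_gt0).
  have : 0 <= \sum_i lval (phi (z i)) *+ coexp i.
    by apply: sumr_ge0 => i _; rewrite phiz mulrn_wge0 // ler0n.
  have := ram_gt0 b n_gt0 a; move: lval_q.
  by move: (lval (phi (ev q))) (\sum_i _) (ram n b a) => u s e; lia.
have [c c0 qE] : exists2 c, c != 0 & q = c%:P.
  have [c c0 ->] := size_poly1P _ size_q; by exists c.
have {}omE : om = eigenform (c^-1 *: p).
  rewrite omE /eigenform; congr (_ *: _); congr (_ * _).
  by rewrite qE pevalC -mul_polyC (rmorphM ev) /= pevalC fmorphV mulrC.
exists (c^-1 *: p) => //; move: omE; set r := _ *: p => omE.
have [->|r0] := eqVneq r 0; first by rewrite size_poly0.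
(* With M the sum of the [coexp i], the expansion at infinity has order M - n deg r - n - 1. That it
   is nonnegative bounds n (deg r + 1) by M. *)
have [phi [P [phiP phix phiz [dx0 dxv]]]] := infinite_place n_gt0 hact L (Ordinal k_gt0).
have := hol P; rewrite omE => /(place_regular hd phiP) [/eqP|].
  rewrite mulf_eq0 (negbTE dx0) orbF fmorph_eq0 mulf_eq0 ev_eq0.
  by rewrite (negbTE r0) (negbTE eigenfun_neq0).
have r0' : phi (ev r) != 0 by rewrite fmorph_eq0 ev_eq0.
have mon0 : phi (monom z coexp) != 0 by rewrite fmorph_eq0 monom_neq0.
rewrite /eigenfun !rmorphM !fmorphV !(valuationM lv) ?mulf_neq0 ?invr_eq0 //.
rewrite !(valuationV lv) // dxv (place_monom n_gt0) (place_ev _ phiP).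
rewrite (@peval_val _ _ _ _ (fun s => (phix s).2) _ (- n%:Z)) //; last first.
- by move=> s; have [] := phix s.
- exact: lcst_val.
have -> : \sum_i lval (phi (z i)) *+ coexp i = - (\sum_i coexp i)%N%:Z.
  rewrite (big_morph Posz PoszD (erefl _)) -sumrN; apply: eq_bigr => i _.
  by rewrite phiz mulNrn natz.
rewrite mulNrn -[X in - X]mulr_natr natz -PoszM leq_divRL //.
rewrite -[in X in _ -> X](@prednK (size r)) ?size_poly_gt0 // mulSn mulnC.
by move: ((size r).-1 * n)%N (\sum_i coexp i)%N => u S; lia.
Qed.

(** * Regularity of the monomial eigenforms at every point *)

Lemma regular_at_scale (P : curve_point X) f g :
  regular_fun P f -> regular_fun P g -> regular_at d P (f *: d g).
Proof.
by move=> Pf Pg; exists 1%N, (fun=> f), (fun=> g); rewrite big_ord1.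
Qed.

Lemma curve_point_valuation (P : curve_point X) : is_valuation (ord P).
Proof. by split; [apply: ord_mul|apply: ord_add]. Qed.

Lemma xfun_sub_neq0 a : x - cst X a != 0.
Proof. by rewrite -(pevalX (cst X) x) -(pevalC (cst X) x) -rmorphB ev_eq0 polyXsubC_eq0. Qed.

Lemma curve_point_zfun (P : curve_point X) i : P (z i) *+ n = P (x - cst X (b i)).
Proof.
by rewrite -(valuationX (curve_point_valuation P)) ?(zfun_neq0 X n_gt0) // zfun_eq.
Qed.

Lemma curve_point_sub_neg (P : curve_point X) a : P x < 0 -> P (x - cst X a) = P x.
Proof.
move=> Px; have x0 : x != 0 by have := xfun_sub_neq0 0; rewrite rmorph0 subr0.
apply: (valuationD_lt (curve_point_valuation P) x0 _).2.
apply: (val_geN (curve_point_valuation P)).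
have [->|a0] := eqVneq a 0; first by left; rewrite rmorph0.
by right; rewrite (ord_cst P) // lezD1.
Qed.

(** Otherwise every x - a has order 0, hence so do the z_i and all nonzero polynomials in x. By the
    normal form no function has a pole at P, contradicting the inverse of a function of order 1. *)
Lemma curve_point_center (P : curve_point X) :
  P x < 0 \/ exists a, 0 < P (x - cst X a).
Proof.
have Pv := curve_point_valuation P.
have [|Px] := ltP (P x) 0; [by left|right].
apply: contrapT => noa.
have P0 a : P (x - cst X a) = 0.
  apply/le_anti; rewrite leNgt; apply/andP; split.
    by apply/negP => Pa; apply: noa; exists a.
  have [/eqP|//] : val_ge P 0 (x - cst X a); last by rewrite (negbTE (xfun_sub_neq0 a)).
  apply: (val_geD Pv); [by right|apply: (val_geN Pv)].
  have [->|a0] := eqVneq a 0; first by left; rewrite rmorph0.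
  by right; rewrite (ord_cst P).
have Pz i : P (z i) = 0.
  by have /eqP := curve_point_zfun P i; rewrite P0 mulrn_eq0 gtn_eqF //= => /eqP.
have Pev q : q != 0 -> P (ev q) = 0.
  move=> q0; rewrite (peval_val xfun_sub_neq0 Pv (@ord_cst _ _ _ _ _ P) P0) //.
  by rewrite mul0rn.
have P_ge f : val_ge P 0 f.
  have [->|f0] := eqVneq f 0; [by left|right].
  have [q q0 [p fq]] := normal_form f.
  have : val_ge P 0 (f * ev q).
    rewrite fq; apply: (val_ge_sum Pv) => e.
    have [->|pe0] := eqVneq (p e) 0; first by left; rewrite rmorph0 mul0r.
    right; rewrite (valuationM Pv) ?ev_eq0 ?monom_neq0 // Pev // add0r.
    rewrite (valuation_prod Pv) => [|i]; last by rewrite expf_neq0 ?(zfun_neq0 X n_gt0).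
    by apply: sumr_ge0 => i _; rewrite (valuationX Pv) ?(zfun_neq0 X n_gt0) // Pz mul0rn.
  case=> [/eqP|]; first by rewrite mulf_eq0 (negbTE f0) ev_eq0 (negbTE q0).
  by rewrite (valuationM Pv) ?ev_eq0 // Pev // addr0.
have [t t0 t1] := ord_normalized P.
have [/eqP|] := P_ge t^-1; first by rewrite invr_eq0 (negbTE t0).
by rewrite (valuationV Pv) // t1.
Qed.

Lemma eigenform_holomorphic m : injective b -> (0 < k)%N ->
  (m.+1 * n < \sum_i coexp i)%N -> holomorphic d (eigenform 'X^m).
Proof.
move=> b_inj k_gt0 lt_m P; have Pv := curve_point_valuation P.
have z0 i : z i != 0 := zfun_neq0 X n_gt0 i.
have PzX i s : P (z i ^+ s) = P (z i) *+ s by rewrite (valuationX Pv).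
have PE : P eigenfun = - \sum_i P (z i) *+ coexp i.
  rewrite (valuationV Pv) ?monom_neq0 // (valuation_prod Pv) => [|i]; last by rewrite expf_neq0.
  by congr (- _); apply: eq_bigr => i _.
have Pnat s : (0 < s)%N -> P s%:R = 0.
  by move=> s0; rewrite -(rmorph_nat (cst X)) ord_cst // pnatr_eq0 -lt0n.
have x0 : x != 0 by have := xfun_sub_neq0 0; rewrite rmorph0 subr0.
rewrite /eigenform rmorphXn /= pevalX.
have [Px|[a Pa]] := curve_point_center P.
  (* At infinity all z_i have the same order w < 0. With z = z_{i0}, dx = - n z^(n+1) d(z^(-1)),
     whose coefficient in the form has order w (n m + n + 1 - M) >= 0. *)
  pose i0 := Ordinal k_gt0; pose w := P (z i0).
  have Pz i : P (z i) = w.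
    have := curve_point_zfun P i; rewrite curve_point_sub_neg //.
    rewrite -(curve_point_sub_neg (b i0)) // -curve_point_zfun.
    by move=> /eqP; rewrite eqrMn2r gtn_eqF //= => /eqP.
  have Pxw : P x = w *+ n by rewrite /w curve_point_zfun curve_point_sub_neg.
  have w_lt0 : w < 0 by move: Px; rewrite Pxw pmulrn_llt0.
  have zV : z i0 = (z i0)^-1^-1 by rewrite invrK.
  rewrite (dxfun i0) zV derivationV // !scalerA; apply: regular_at_scale; right; last first.
    by rewrite (valuationV Pv) // -/w oppr_ge0 ltW.
  rewrite -zV exprVn invrK mulrN.
  have [nX zX] : (n%:R : X) != 0 /\ forall s, z i0 ^+ s != 0.
    by split=> [|s]; rewrite ?nat_neq0 ?expf_neq0.
  rewrite (valuationN Pv) ?mulf_neq0 ?expf_neq0 ?eigenfun_neq0 //.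
  rewrite !(valuationM Pv) ?mulf_neq0 ?expf_neq0 ?eigenfun_neq0 //.
  rewrite !(valuationX Pv) // PE Pnat // Pxw -/w.
  under eq_bigr do rewrite Pz.
  have wn : w + w + w *+ n.-1 = w *+ n.+1 by rewrite -{2}(prednK n_gt0) !mulrS addrA.
  rewrite sumrMnr add0r -mulrnA -addrA [w *+ n.-1 + _]addrC wn addrAC -mulrnDr.
  rewrite subr_ge0; apply: ler_wnMn2l; first exact: ltW.
  by apply: leq_trans lt_m; rewrite mulSn mulnC; lia.
(* From here on P lies over the finite value a. If b_i differs from a, then z_i^n = (a - b_i) + (x -
   a) is a unit. *)
have P0 i : b i != a -> P (z i) = 0.
  move=> nba; have ab0 : a - b i != 0 by rewrite subr_eq0 eq_sym.
  suff Pb : P (x - cst X (b i)) = 0.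
    by have /eqP := curve_point_zfun P i; rewrite Pb mulrn_eq0 gtn_eqF //= => /eqP.
  have -> : x - cst X (b i) = cst X (a - b i) + (x - cst X a).
    by rewrite rmorphB; ring.
  rewrite -(ord_cst P ab0); apply: (valuationD_lt Pv _ _).2; first by rewrite fmorph_eq0.
  by right; rewrite (ord_cst P ab0) add0r -gtz0_ge1.
have Px : 0 <= P x.
  have [/eqP|//] : val_ge P 0 x; last by rewrite (negbTE x0).
  rewrite -[x](subrK (cst X a)); apply: (val_geD Pv); first by right; apply: ltW.
  have [->|a0] := eqVneq a 0; first by left; rewrite rmorph0.
  by right; rewrite (ord_cst P).
(* If a is none of the b_i, all z_i are units, and the coefficient of dx is regular. *)
have [[i0 /eqP ba]|nb] := pselect (exists i, b i == a); last first.
  apply: regular_at_scale; right => //.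
  rewrite (valuationM Pv) ?expf_neq0 ?eigenfun_neq0 // (valuationX Pv) // PE.
  rewrite big1 ?subr0 ?mulrn_wge0 // => i _; rewrite P0 ?mul0rn //.
  by apply/negP => ba; apply: nb; exists i.
have w_gt0 : 0 < P (z i0).
  by rewrite -(pmulrn_lgt0 _ n_gt0) curve_point_zfun ba.
(* Over b_{i0}, with z = z_{i0} and j = j_{i0}, dx = n z^(n-1) dz, and since the b_i are distinct
   [eigenfun] has the order of z^(j-n). The coefficient has order at least (j - 1) P(z) >= 0. *)
rewrite (dxfun i0) scalerA; apply: regular_at_scale; right; last exact: ltW.
have [nX zX] : (n%:R : X) != 0 /\ forall s, z i0 ^+ s != 0.
  by split=> [|s]; rewrite ?nat_neq0 ?expf_neq0.
rewrite !(valuationM Pv) ?mulf_neq0 ?expf_neq0 ?eigenfun_neq0 //.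
rewrite !(valuationX Pv) // PE Pnat // (bigD1 i0) //= big1 => [|i nei].
  rewrite addr0 add0r -addrA addr_ge0 ?mulrn_wge0 // addrC subr_ge0.
  by apply: ler_wpMn2l; [apply: ltW|have := j_gt0 i0; rewrite /coexp; lia].
by rewrite P0 ?mul0rn // -ba (inj_eq b_inj).
Qed.

End Eigenforms.
End Forms.

(** * The coordinate on the projective line and the character at infinity *)

(** Applying the inverse matrix h, the homogeneous coordinates of p and p' are both multiples of h
    (r, 1), so the two points coincide. *)
Lemma mobius_inj_affine (R : realType) (g : 'M[R[i]]_2) (p p' : P1 R) r :
  g \in unitmx -> mobius g p = Some r -> mobius g p' = Some r -> p = p'.
Proof.
move=> gU; pose h := invmx g.
have hg i j : h i 0 * g 0 j + h i 1 * g 1 j = (i == j)%:R.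
  have /matrixP/(_ i j) := mulVmx gU; rewrite !mxE !big_ord_recl big_ord0 addr0 => <-.
  by congr (_ + h _ _ * g _ _); apply: val_inj.
pose coords (q : P1 R) := if q is Some c then (c, 1) else (1, 0) : R[i] * R[i].
pose den q := g 1 0 * (coords q).1 + g 1 1 * (coords q).2.
pose num q := g 0 0 * (coords q).1 + g 0 1 * (coords q).2.
have coordsE q : mobius g q = Some r ->
    (coords q).1 = (h 0 0 * r + h 0 1) * den q /\ (coords q).2 = (h 1 0 * r + h 1 1) * den q.
  have -> : mobius g q = if den q == 0 then None else Some (num q / den q).
    by rewrite /num /den /coords; case: q.
  case: eqP => // /eqP d0 [rE].
  have numE : num q = r * den q by rewrite -rE divfK.
  have rowE i : (h i 0 * r + h i 1) * den q =
      (i == 0)%:R * (coords q).1 + (i == 1)%:R * (coords q).2.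
    by rewrite mulrDl -mulrA -numE -!hg /num /den; ring.
  by rewrite !rowE /= !mul1r !mul0r addr0 add0r.
move=> /coordsE[pE1 pE2] /coordsE[p'E1 p'E2].
have : (coords p).1 * (coords p').2 = (coords p').1 * (coords p).2.
  by rewrite pE1 pE2 p'E1 p'E2; ring.
case: (p) (p') => [c|] [c'|] //=; rewrite ?mulr1 ?mulr0 ?mul1r => /eqP.
- by move/eqP->.
- by rewrite eq_sym oner_eq0.
- by rewrite oner_eq0.
Qed.

Section Characters.
Variables (R : realType) (n k : nat) (chi : H1 n k -> R[i]) (j : 'I_k.+1 -> nat).
Local Notation zeta := (expi (2 * pi / n%:R : R)).
Hypotheses (n_gt0 : (0 < n)%N) (hchi : is_character chi) (j_lt : forall i, (j i < n)%N).
Hypothesis chi_delta : forall i, chi (delta n i) = zeta ^+ j i.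
Hypothesis chi_delta0 : chi (delta n ord0) <> 1.

Lemma character_delta0 : chi (delta n ord0) * zeta ^+ (\sum_(i < k) j (lift ord0 i)) = 1.
Proof.
have [chi0 chiD] := hchi.
have -> : zeta ^+ (\sum_(i < k) j (lift ord0 i)) = chi (\sum_(i < k) delta_mx 0 i).
  rewrite (big_morph chi chiD chi0) -prodrXr.
  by apply: eq_bigr => i _; rewrite -delta_lift chi_delta.
by rewrite -chiD /delta unlift_none addNr chi0.
Qed.

(** The sums of the n - j_i and of the j_i add up to a multiple of n. If n divided the first, it
    would divide the second, and chi(delta_0) would be 1. *)
Lemma ndvd_sum_coexp : ~~ (n %| \sum_(i < k) coexp n (fun i => j (lift ord0 i)) i)%N.
Proof.
apply/negP => n_dvd; apply: chi_delta0.
have := character_delta0; have /eqP : zeta ^+ (\sum_(i < k) j (lift ord0 i)) = 1.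
  apply/eqP; rewrite -(prim_order_dvd (expi_prim R n_gt0)) -(dvdn_addr _ n_dvd) -big_split /=.
  by apply: dvdn_sum => i _; rewrite subnK // ltnW.
by move=> /eqP->; rewrite mulr1.
Qed.

End Characters.

(** * A basis of the eigenspace *)

Theorem proposition3p4 (R : realType) (n k : nat) (hn : (2 <= n)%N)
  (* the points a_0, ..., a_k, and a coordinate on P^1 with a_0 at infinity *)
  (a : 'I_k.+1 -> P1 R) (ha : injective a)
  (g : 'M[R[i]]_2) (hg : g \in unitmx)
  (b : 'I_k -> R[i]) (hg0 : mobius g (a ord0) = None)
  (hb : forall i : 'I_k, mobius g (a (lift ord0 i)) = Some (b i))
  (X : abelian_cover n b)
  (act : H1 n k -> {rmorphism X -> X}) (hact : galois_action act)
  (Om : lmodType X) (d : X -> Om) (hd : kaehler d)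
  (pb : forall u : H1 n k, {linear Om -> Om | act u \; *:%R})
  (hpb : is_pullback d pb)
  (chi : H1 n k -> R[i]) (hchi : is_character chi)
  (hchi1 : exists u : H1 n k, chi u <> 1)
  (j : 'I_k.+1 -> nat) (hj : forall i : 'I_k.+1, (1 <= j i < n)%N)
  (hchij : forall i : 'I_k.+1,
     chi (delta n i) = expi (2 * pi * (j i)%:R / n%:R) /\ chi (delta n i) <> 1)
  (hgcd : \big[gcdn/0%N]_(i < k.+1) j i = 1%N)
  (M : nat) (hM : M = (\sum_(i < k) (n - j (lift ord0 i)))%N) :
  has_dim (H10chi d pb chi) (M %/ n)%N.
Proof.
have n_gt0 : (0 < n)%N := ltnW hn.
(* For k = 0 the element delta_0 is an empty sum, so chi(delta_0) = 1, against the hypothesis. *)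
have k_gt0 : (0 < k)%N.
  case: k chi hchi j hchij {a ha hg0 hb b X act hact Om d hd pb hpb hchi1 hj hgcd hM};
    last by [].
  move=> chi [chi0 _] j.
  by move=> /(_ ord0)[_ []]; rewrite /delta unlift_none big_ord0 oppr0.
have b_inj : injective b.
  move=> i i' bii'; apply: (@lift_inj _ ord0); apply: ha.
  by apply: (mobius_inj_affine hg (hb i)); rewrite hb bii'.
have chi_delta i : chi (delta n i) = expi (2 * pi / n%:R) ^+ j i.
  by have [-> _] := hchij i; rewrite -expiMn mulrAC mulr_natr.
have j_lt i : (j i < n)%N by have /andP[] := hj i.
have j_gt0 i : (0 < j i)%N by have /andP[] := hj i.
pose j' i := j (lift ord0 i).
have ndvd := ndvd_sum_coexp n_gt0 hchi j_lt chi_delta (hchij ord0).2.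
rewrite hM -/(\sum_(i < k) coexp n j' i)%N.
set N := (_ %/ n)%N.
exists (fun i : 'I_N => eigenform d j' 'X^i); split.
- move=> i; split; last first.
    exact: (eigenform_pullback n_gt0 hact hpb hchi (fun i => j_lt (lift ord0 i))
      (fun i => chi_delta (lift ord0 i))).
  apply: (eigenform_holomorphic n_gt0 hact hd _ b_inj k_gt0) => [i'|]; first exact: j_gt0.
  (* From i < M / n follows (i + 1) n <= M; equality is excluded because n does not divide M. *)
  rewrite ltn_neqAle -leq_divRL // ltn_ord andbT.
  by apply: contraNneq ndvd => <-; apply: dvdn_mull.
- move=> om [hol eig].
  have [p size_p ->] := holomorphic_eigenform n_gt0 hact hd hpb (fun i => j_lt (lift ord0 i))
    (fun i => chi_delta (lift ord0 i)) k_gt0 hol eig.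
  exists (fun i => p`_i); rewrite eigenform_sum; congr (eigenform _ _ _).
  rewrite -(poly_def N (fun i => p`_i)); apply/polyP => i; rewrite coef_poly.
  by case: ltnP => // leNi; rewrite nth_default // (leq_trans size_p).
move=> c /eqP; rewrite eigenform_sum (eigenform_eq0 n_gt0 hact hd) => /eqP sum0 i.
have := congr1 (fun p : {poly R[i]} => p`_i) sum0; rewrite coef0 coef_sum => <-.
rewrite (bigD1 i) //= coefZ coefXn eqxx mulr1 big1 ?addr0 // => i' nei.
by rewrite coefZ coefXn eq_sym val_eqE (negbTE nei) mulr0.
Qed.
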